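(* Let $k\in\mathbb{N}$. Then there exists a continuous linear operator $\mathfrak{a}_k\colon \mathcal{S}^*(Z) \rightarrow \mathcal{S}^*(Z)$ (continuous for the strong topology) such that $$\widehat{\mathfrak{a}_k\Phi}(\sigma)=[1-\mathbf{1}_{\sigma}(k)]\,\widehat{\Phi}(\sigma\cup k),\quad \sigma\in\Gamma,\ \Phi\in\mathcal{S}^*(Z).$$
   Context: $\mathbb{N}=\{0,1,2,\dots\}$ and $\Gamma$ is the set of all finite subsets of $\mathbb{N}$; for $\sigma\in\Gamma$, $k\in\mathbb{N}$, write $\sigma\cup k=\sigma\cup\{k\}$ and $\mathbf{1}_\sigma$ for the indicator of $\sigma$. $(\Omega,\mathcal{F},P)$ is a probability space with expectation $\mathbb{E}$. A discrete-time normal noise is a sequence $Z=(Z_n)_{n\in\mathbb{N}}$ of integrable (real) random variables on $\Omega$ with $\mathbb{E}[Z_n\mid\mathcal{F}_{n-1}]=0$ and $\mathbb{E}[Z_n^2\mid\mathcal{F}_{n-1}]=1$ for all $n\ge 0$, where $\mathcal{F}_{-1}=\{\emptyset,\Omega\}$ and $\mathcal{F}_n=\sigma(Z_k;0\le k\le n)$. Put $Z_\emptyset=1$ and $Z_\sigma=\prod_{i\in\sigma}Z_i$ for nonempty $\sigma\in\Gamma$; $\{Z_\sigma\mid\sigma\in\Gamma\}$ is an orthonormal system. Let $\mathcal{F}_\infty=\sigma(Z_n;n\in\mathbb{N})$ and let $\mathcal{L}^2(Z)=\mathcal{L}^2(\Omega,\mathcal{F}_\infty,P)$ (complex-valued functions),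 with inner product $\langle\cdot,\cdot\rangle$ conjugate-linear in the first and linear in the second argument. $Z$ is a fixed discrete-time normal noise having the chaotic representation property: $\{Z_\sigma\}$ is total in $\mathcal{L}^2(Z)$, hence an orthonormal basis of it. $\lambda_\emptyset=1$ and $\lambda_\sigma=\prod_{k\in\sigma}(k+1)$ for nonempty $\sigma\in\Gamma$. For real $p\ge0$, $\mathcal{S}_p(Z)=\{\xi\in\mathcal{L}^2(Z)\mid\|\xi\|_p^2:=\sum_{\sigma\in\Gamma}\lambda_\sigma^{2p}|\langle Z_\sigma,\xi\rangle|^2<\infty\}$, a Hilbert space. $\mathcal{S}(Z)=\bigcap_{p\ge0}\mathcal{S}_p(Z)$ has the topology generated by the norms $\|\cdot\|_p$, $p\ge 0$; it is a nuclear countably-Hilbert space containing every $Z_\sigma$. $\mathcal{S}^*(Z)$ is the dual (continuous linear functionals) of $\mathcal{S}(Z)$ with the strong topology. For $\Phi\in\mathcal{S}^*(Z)$, its Fock transform is the function $\widehat\Phi(\sigma)=\Phi(Z_\sigma)$, $\sigma\in\Gamma$; $\Phi$ is determined by $\widehat\Phi$. *)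

(* Defs.v *)
From HB Require Import structures.
From mathcomp Require Import all_boot all_order all_algebra finmap.
From mathcomp Require Import generic_quotient ring_quotient complex.
From mathcomp Require Import lra ring.
From mathcomp Require Import all_classical all_reals all_analysis measurable_realfun.
Set Implicit Arguments. Unset Strict Implicit. Unset Printing Implicit Defensive.
Import Order.TTheory GRing.Theory Num.Theory numFieldNormedType.Exports.
Local Open Scope classical_set_scope. Local Open Scope ring_scope.

Section sub_sigma_algebra.
Context d (T : measurableType d) (R : realType) (P : probability T R).
Variable G : set_system T.
Hypothesis Gm : G `<=` measurable.

Lemma sub_sigma_measurable : <<s G >> `<=` (measurable : set_system T).
Proof.
apply: smallest_sub => //; split=> [|A mA|F mF]; first exact: measurable0.
  by rewrite setTD; exact: measurableC.
exact: bigcup_measurable.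
Qed.

Lemma sub_sigma_measurable_fun d' (T' : measurableType d') (f : T -> T') :
  measurable_fun setT (f : g_sigma_algebraType G -> T') -> measurable_fun setT f.
Proof.
move=> mf _ A mA; apply: sub_sigma_measurable.
exact: (mf measurableT A mA).
Qed.

Import HBNNSimple.

Lemma nnsfun_weighted (U : T -> R) (h : {nnsfun (g_sigma_algebraType G) >-> R}) :
  measurable_fun setT U -> (forall x, 0 <= U x) ->
  (\int[P]_x (h x * U x)%:E =
   \sum_(y \in range h) (y%:E * \int[P]_(x in h @^-1` [set y]) (U x)%:E))%E.
Proof.
move=> mU U0.
have mpre y : measurable (h @^-1` [set y] : set T).
  by apply: sub_sigma_measurable; exact: (measurable_sfunP h (measurable_set1 y)).
have mind y : measurable_fun setT (\1_(h @^-1` [set y]) : T -> R).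
  exact: measurable_indic.
have -> : (\int[P]_x (h x * U x)%:E =
    \int[P]_x \sum_(y \in range h) ((y * \1_(h @^-1` [set y]) x * U x)%:E))%E.
  apply: eq_integral => x _.
  rewrite fsumEFin//; congr EFin.
  rewrite [in LHS](fimfunE h x) mulr_fsuml//.
rewrite ge0_integral_fsum//.
- apply: eq_fsbigr => y /[!inE] -[x _ <-{y}].
  have hx0 : 0 <= h x by exact: fun_ge0.
  under eq_integral do rewrite -mulrA EFinM.
  rewrite ge0_integralZl_EFin//.
  + congr (_ * _)%E.
    rewrite [RHS]integral_mkcond; apply: eq_integral => t _.
    by rewrite epatch_indic/= EFinM muleC.
  + by move=> t _; rewrite lee_fin mulr_ge0.
  + by apply/measurable_EFinP; exact: measurable_funM.
- move=> y; apply/measurable_EFinP.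
  by apply: measurable_funM => //; exact: measurable_funM.
- move=> y x _; rewrite lee_fin mulr_ge0//.
  exact: nnfun_muleindic_ge0.
Qed.

Lemma ge0_integral_weighted (U V X : T -> R) :
  measurable_fun setT U -> (forall x, 0 <= U x) ->
  measurable_fun setT V -> (forall x, 0 <= V x) ->
  (forall A, <<s G >> A ->
    \int[P]_(x in A) (U x)%:E = \int[P]_(x in A) (V x)%:E)%E ->
  measurable_fun setT (X : g_sigma_algebraType G -> R) ->
  (forall x, 0 <= X x) ->
  (\int[P]_x (X x * U x)%:E = \int[P]_x (X x * V x)%:E)%E.
Proof.
move=> mU U0 mV V0 UV mX X0.
have mEX : measurable_fun setT (EFin \o X : g_sigma_algebraType G -> \bar R).
  exact/measurable_EFinP.
have E0 x : (0 <= (EFin \o X) x)%E by rewrite lee_fin.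
pose h := nnsfun_approx measurableT mEX.
have hlim (W : T -> R) : measurable_fun setT W -> (forall x, 0 <= W x) ->
  (\int[P]_x (X x * W x)%:E = limn (fun n => \int[P]_x (h n x * W x)%:E))%E.
  move=> mW W0.
  have XW x : ((X x * W x)%:E = limn (fun n => (h n x * W x)%:E))%E.
    apply/esym/cvg_lim => //.
    under eq_fun do rewrite EFinM.
    rewrite EFinM; apply: cvgeZr => //.
    exact: (@cvg_nnsfun_approx _ (g_sigma_algebraType G) R setT measurableT _ mEX).
  under eq_integral => x _ do rewrite XW.
  apply: monotone_convergence => //.
  - move=> n; apply/measurable_EFinP; apply: measurable_funM => //.
    apply: sub_sigma_measurable_fun; exact: measurable_funP.
  - by move=> n x _; rewrite lee_fin mulr_ge0// fun_ge0.
  - move=> x _ a b ab; rewrite lee_fin ler_wpM2r//.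
    have /lefP := @nd_nnsfun_approx _ (g_sigma_algebraType G) R setT measurableT _ mEX a b ab.
    exact.
rewrite !hlim//; congr (limn _); apply/funext => n.
rewrite !nnsfun_weighted//; apply: eq_fsbigr => y _; rewrite UV//.
exact: (measurable_sfunP (h n) (measurable_set1 y)).
Qed.

Lemma integral_weighted (U V X : T -> R) :
  P.-integrable setT (EFin \o U) -> P.-integrable setT (EFin \o V) ->
  (forall A, <<s G >> A ->
    \int[P]_(x in A) (U x)%:E = \int[P]_(x in A) (V x)%:E)%E ->
  measurable_fun setT (X : g_sigma_algebraType G -> R) ->
  P.-integrable setT (EFin \o (X \* U)) ->
  P.-integrable setT (EFin \o (X \* V)) ->
  \int[P]_x (X x * U x) = \int[P]_x (X x * V x).
Proof.
move=> iU iV UV mX iXU iXV.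
have mU : measurable_fun setT U by apply/measurable_EFinP; exact: measurable_int iU.
have mV : measurable_fun setT V by apply/measurable_EFinP; exact: measurable_int iV.
have mXT : measurable_fun setT (X : T -> R) by exact: sub_sigma_measurable_fun.
pose C x := `|U x| + `|V x|.
have mC : measurable_fun setT C by apply: measurable_funD; exact: measurableT_comp.
have mnX : measurable_fun setT (fun x => `|X x| : R).
  exact: measurableT_comp.
have iC : P.-integrable setT (EFin \o C).
  rewrite (_ : EFin \o C = (fun x => `|(U x)%:E| + `|(V x)%:E|)%E)//.
  by apply: integrableD => //; exact: integrable_abse.
have le_int (f g : T -> R) : measurable_fun setT f -> (forall x, `|f x| = `|g x|) ->
    P.-integrable setT (EFin \o g) -> P.-integrable setT (EFin \o f).
  move=> mf fg; apply: le_integrable => //; first exact/measurable_EFinP.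
  by move=> x _ /=; rewrite lee_fin fg.
have addi (f g : T -> R) : P.-integrable setT (EFin \o f) ->
    P.-integrable setT (EFin \o g) -> P.-integrable setT (EFin \o (f \+ g)).
  by move=> fi gi; rewrite (_ : EFin \o _ = ((EFin \o f) \+ (EFin \o g))%E)//;
    exact: integrableD.
have iXC : P.-integrable setT (EFin \o (X \* C)).
  apply: (@le_int _ ((fun x => `|X x * U x|) \+ (fun x => `|X x * V x|))).
  - exact: measurable_funM.
  - by move=> x /=; rewrite /C !normrM -mulrDr normrM normr_id.
  - by apply: addi; [exact: (integrable_abse iXU)|exact: (integrable_abse iXV)].
have inXW (W : T -> R) : measurable_fun setT W -> P.-integrable setT (EFin \o (X \* W)) ->
    P.-integrable setT (EFin \o ((fun x => `|X x|) \* W)).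
  move=> mW; apply: le_int; first exact: measurable_funM.
  by move=> x /=; rewrite !normrM normr_id.
have main : \int[P]_x (X x * (U x + C x)) = \int[P]_x (X x * (V x + C x)).
  have UVC A : <<s G >> A ->
      (\int[P]_(x in A) (U x + C x)%:E = \int[P]_(x in A) (V x + C x)%:E)%E.
    move=> GA; have mA := sub_sigma_measurable GA.
    under eq_integral do rewrite EFinD.
    under [RHS]eq_integral do rewrite EFinD.
    rewrite !integralD//; last 4 first.
      - exact: (integrableS measurableT).
      - exact: (integrableS measurableT).
      - exact: (integrableS measurableT).
      - exact: (integrableS measurableT).
    by rewrite UV.
  have UC0 x : 0 <= U x + C x.
    by rewrite /C addrA addr_ge0// -lerBlDl sub0r -normrN ler_norm.
  have VC0 x : 0 <= V x + C x.
    by rewrite /C addrCA addr_ge0// -lerBlDl sub0r -normrN ler_norm.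
  have mUC : measurable_fun setT (fun x => U x + C x) by exact: measurable_funD.
  have mVC : measurable_fun setT (fun x => V x + C x) by exact: measurable_funD.
  have mnXG : measurable_fun setT
      (fun x : g_sigma_algebraType G => `|X x| : R).
    exact: measurableT_comp.
  have e1 : \int[P]_x (`|X x| * (U x + C x)) = \int[P]_x (`|X x| * (V x + C x)).
    by congr fine; exact: (@ge0_integral_weighted _ _ (fun x => `|X x|)).
  have e2 : \int[P]_x ((`|X x| + X x) * (U x + C x)) =
            \int[P]_x ((`|X x| + X x) * (V x + C x)).
    congr fine; apply: (@ge0_integral_weighted _ _ (fun x => `|X x| + X x)) => //.
      exact: measurable_funD.
    by move=> x; rewrite -lerBlDr sub0r -normrN ler_norm.
  have iXUC : P.-integrable setT (EFin \o (X \* (U \+ C))).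
    rewrite (_ : X \* _ = (X \* U) \+ (X \* C)); first exact: addi.
    by apply/funext => x /=; rewrite mulrDr.
  have iXVC : P.-integrable setT (EFin \o (X \* (V \+ C))).
    rewrite (_ : X \* _ = (X \* V) \+ (X \* C)); first exact: addi.
    by apply/funext => x /=; rewrite mulrDr.
  move: e2; under eq_Rintegral do rewrite mulrDl.
  under [RHS]eq_Rintegral do rewrite mulrDl.
  rewrite (RintegralD measurableT (inXW _ mUC iXUC) iXUC).
  rewrite (RintegralD measurableT (inXW _ mVC iXVC) iXVC).
  by rewrite e1 => /addrI.
move: main; under eq_Rintegral do rewrite mulrDr.
under [RHS]eq_Rintegral do rewrite mulrDr.
by rewrite !RintegralD// => /addIr.
Qed.

End sub_sigma_algebra.

Section conditional_expectation.
Context d (T : measurableType d) (R : realType) (P : probability T R).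

(* [Y] is a version of the conditional expectation of [X] given <<s G >> *)
Definition is_cond_expectation (G : set_system T) (X Y : T -> R) : Prop :=
  [/\ P.-integrable setT (EFin \o X), P.-integrable setT (EFin \o Y),
      measurable_fun setT (Y : g_sigma_algebraType G -> R) &
      forall A, <<s G >> A ->
        (\int[P]_(x in A) (X x)%:E = \int[P]_(x in A) (Y x)%:E)%E].

(* generators of the sigma-algebra of the variables Z_i, i in I; for empty I
   the generated sigma-algebra is trivial *)
Definition noise_events (Z : nat -> {RV P >-> R}) (I : set nat) : set_system T :=
  \bigcup_(i in I) preimage_set_system setT (Z i) measurable.

(* <<s noise_events Z `I_n >> is F_(n-1), with F_(-1) trivial for n = 0 *)
Record normal_noise := NormalNoise {
  noise :> nat -> {RV P >-> R} ;
  noise_integrable : forall n, P.-integrable setT (EFin \o noise n) ;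
  noise_mean : forall n,
    is_cond_expectation (noise_events noise `I_n) (noise n) (cst 0) ;
  noise_variance : forall n,
    is_cond_expectation (noise_events noise `I_n)
      (fun x => noise n x ^+ 2) (cst 1) }.

Definition noise_prod (Z : nat -> {RV P >-> R}) (s : {fset nat}) (x : T) : R :=
  \prod_(i <- s) Z i x.

End conditional_expectation.

Section noise_products.
Context d (T : measurableType d) (R : realType) (P : probability T R).
Variable Z : normal_noise P.
Local Notation E I := (noise_events Z I).
Local Notation Zs := (noise_prod Z).

Lemma noise_events_measurable I : E I `<=` measurable.
Proof.
move=> _ [i _] [B mB <-]; rewrite setTI -[X in measurable X]setTI.
exact: (measurable_funP (Z i)).
Qed.

Lemma noise_measurable (I : set nat) i : I i ->
  measurable_fun setT (Z i : g_sigma_algebraType (E I) -> R).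
Proof.
move=> Ii _ B mB; apply: sub_sigma_algebra; exists i => //.
by exists B.
Qed.

Lemma noise_prod_measurable (I : set nat) (s : {fset nat}) :
  (forall i, i \in s -> I i) ->
  measurable_fun setT (Zs s : g_sigma_algebraType (E I) -> R).
Proof.
rewrite /noise_prod => sI.
have {}sI : all (fun i => `[< I i >]) s by apply/allP => i /sI Ii; apply/asboolP.
elim: (s : seq nat) sI => [_|i l IH /= /andP[/asboolP Ii Il]].
  rewrite (_ : (fun _ => _) = cst 1); first exact: measurable_cst.
  by apply/funext => x; rewrite big_nil.
rewrite (_ : (fun _ => _) = (fun x => Z i x * \prod_(j <- l) Z j x)).
  by apply: measurable_funM; [exact: noise_measurable|exact: IH].
by apply/funext => x; rewrite big_cons.
Qed.

Lemma noise_prodT s : measurable_fun setT (Zs s).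
Proof.
apply: (@sub_sigma_measurable_fun _ _ _ (@noise_events_measurable setT)).
exact: noise_prod_measurable.
Qed.

Lemma noise_prodD1 n (s : {fset nat}) : n \in s ->
  Zs s = (fun x => Z n x * Zs (s `\ n)%fset x).
Proof. by move=> ns; apply/funext => x; rewrite /noise_prod (big_fsetD1 n). Qed.

Lemma noise_prod_below n (s : {fset nat}) :
  (forall i, i \in s -> (i < n.+1)%N) ->
  forall i, i \in (s `\ n)%fset -> (i < n)%N.
Proof.
move=> sn i; rewrite !inE => /andP[ni /sn]; rewrite ltnS leq_eqVlt.
by rewrite (negbTE ni).
Qed.

Lemma noise_prod_below1 n (s : {fset nat}) :
  (forall i, i \in s -> (i < n.+1)%N) -> n \notin s ->
  forall i, i \in s -> (i < n)%N.
Proof.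
move=> sn ns i si; have := sn _ si; rewrite ltnS leq_eqVlt => /predU1P[in_|//].
by rewrite -in_ si in ns.
Qed.

Lemma noise_prod_sqr_lty s : (\int[P]_x ((Zs s x) ^+ 2)%:E < +oo)%E.
Proof.
have [n sn] : exists n, forall i, i \in s -> (i < n)%N.
  exists (\max_(i <- s) i).+1 => i si; rewrite ltnS.
  by rewrite (big_fsetD1 i)//= leq_maxl.
elim: n s sn => [s s0|n IH s sn].
  rewrite (_ : s = fset0); last first.
    by apply/fsetP => i; rewrite inE; apply/negbTE/negP => /s0.
  under eq_integral do rewrite /noise_prod big_seq_fset0 expr1n.
  rewrite integral_cst// mul1e. by rewrite ltey_eq fin_num_measure.
have [ns|ns] := boolP (n \in s); last by apply: IH; exact: noise_prod_below1 ns.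
rewrite (noise_prodD1 ns); have sn' := noise_prod_below sn.
have := IH _ sn'; congr (_ < _)%E.
have [_ _ _ vn] := noise_variance Z n.
under [RHS]eq_integral do rewrite exprMn mulrC.
under [LHS]eq_integral do rewrite -[X in X%:E]mulr1.
symmetry; apply: (@ge0_integral_weighted _ _ _ _ _ (@noise_events_measurable `I_n)
  (fun x => Z n x ^+ 2) (cst 1) (fun x => Zs (s `\ n)%fset x ^+ 2)) => //.
- by apply: measurable_funX; exact: measurable_funP.
- by move=> x; exact: sqr_ge0.
- apply: measurable_funX; exact: noise_prod_measurable.
- by move=> x; exact: sqr_ge0.
Qed.

Lemma integrable_mul_sqr (f g : T -> R) :
  measurable_fun setT f -> (\int[P]_x ((f x) ^+ 2)%:E < +oo)%E ->
  measurable_fun setT g -> (\int[P]_x ((g x) ^+ 2)%:E < +oo)%E ->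
  P.-integrable setT (EFin \o (f \* g)).
Proof.
move=> mf f2 mg g2; apply/integrableP; split.
  by apply/measurable_EFinP; exact: measurable_funM.
have mf2 : measurable_fun setT (fun x => (f x ^+ 2)%:E).
  by apply/measurable_EFinP; exact: measurable_funX.
have mg2 : measurable_fun setT (fun x => (g x ^+ 2)%:E).
  by apply/measurable_EFinP; exact: measurable_funX.
apply: (@le_lt_trans _ _ (\int[P]_x ((f x ^+ 2)%:E + (g x ^+ 2)%:E))%E).
  apply: ge0_le_integral => //.
  - apply/measurable_EFinP; apply: measurableT_comp => //; exact: measurable_funM.
  - exact: emeasurable_funD.
  move=> x _ /=; rewrite lee_fin normrM -(real_normK (num_real (f x))).
  rewrite -(real_normK (num_real (g x))).
  set a := `|f x|; set b := `|g x|.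
  have : 0 <= (a - b) ^+ 2 + (a ^+ 2 + b ^+ 2) by rewrite !addr_ge0 ?sqr_ge0.
  by lra.
rewrite ge0_integralD//; last 2 first.
- by move=> x _; rewrite lee_fin sqr_ge0.
- by move=> x _; rewrite lee_fin sqr_ge0.
by rewrite lte_add_pinfty.
Qed.

Lemma noise_prodM_integrable s t : P.-integrable setT (EFin \o (Zs s \* Zs t)).
Proof.
by apply: integrable_mul_sqr; solve [exact: noise_prodT|exact: noise_prod_sqr_lty].
Qed.

Lemma noise_prod_orthogonal1 n (s t : {fset nat}) :
  (forall i, i \in s -> (i < n.+1)%N) -> (forall i, i \in t -> (i < n.+1)%N) ->
  n \in s -> n \notin t -> \int[P]_x (Zs s x * Zs t x) = 0.
Proof.
move=> sn tn ns nt; have [iZ i0 _ mn] := noise_mean Z n.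
have sE : (Zs (s `\ n)%fset \* Zs t) \* Z n = Zs s \* Zs t.
  by apply/funext => x; rewrite (noise_prodD1 ns)/= mulrC mulrA.
transitivity (\int[P]_x ((Zs (s `\ n)%fset x * Zs t x) * cst 0 x)); last first.
  under eq_Rintegral do rewrite mulr0.
  by rewrite Rintegral_cst// mul0r.
transitivity (\int[P]_x ((Zs (s `\ n)%fset x * Zs t x) * Z n x)).
  by apply: eq_Rintegral => x _; rewrite -[LHS]/((Zs s \* Zs t) x) -sE.
apply: (@integral_weighted _ _ _ _ _ (@noise_events_measurable `I_n)
  (Z n) (cst 0) (Zs (s `\ n)%fset \* Zs t)) => //.
- apply: measurable_funM; apply: noise_prod_measurable.
    exact: noise_prod_below.
  exact: noise_prod_below1 nt.
- by rewrite sE; exact: noise_prodM_integrable.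
- rewrite (_ : _ \* _ = cst 0); last by apply/funext => x /=; rewrite mulr0.
  exact: i0.
Qed.

Lemma noise_prod_orthogonal s t : s != t -> \int[P]_x (Zs s x * Zs t x) = 0.
Proof.
have [n [sn tn]] : exists n, (forall i, i \in s -> (i < n)%N) /\
    (forall i, i \in t -> (i < n)%N).
  exists (\max_(i <- (s `|` t)%fset) i).+1.
  by split=> i si; rewrite ltnS (big_fsetD1 i)//= ?leq_maxl// inE si ?orbT.
elim: n s t sn tn => [s t s0 t0|n IH s t sn tn].
  move=> /negP; case; apply/eqP/fsetP => i.
  by apply/idP/idP => [/s0|/t0].
have [ns|ns] := boolP (n \in s); have [nt|nt] := boolP (n \in t) => st.
- have [iZ i1 _ vn] := noise_variance Z n.
  have sE : (Zs (s `\ n)%fset \* Zs (t `\ n)%fset) \* (fun x => Z n x ^+ 2) =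
      Zs s \* Zs t.
    apply/funext => x; rewrite (noise_prodD1 ns) (noise_prodD1 nt)/=.
    by rewrite expr2 [RHS]mulrACA [RHS]mulrC.
  have st' : (s `\ n)%fset != (t `\ n)%fset.
    by apply: contra st => /eqP e; rewrite -(fsetD1K ns) -(fsetD1K nt) e.
  rewrite -[RHS](IH _ _ (noise_prod_below sn) (noise_prod_below tn) st').
  transitivity (\int[P]_x ((Zs (s `\ n)%fset x * Zs (t `\ n)%fset x) * Z n x ^+ 2)).
    by apply: eq_Rintegral => x _; rewrite -[LHS]/((Zs s \* Zs t) x) -sE.
  transitivity (\int[P]_x ((Zs (s `\ n)%fset x * Zs (t `\ n)%fset x) * cst 1 x));
    last by apply: eq_Rintegral => x _; rewrite mulr1.
  apply: (@integral_weighted _ _ _ _ _ (@noise_events_measurable `I_n)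
    (fun x => Z n x ^+ 2) (cst 1) (Zs (s `\ n)%fset \* Zs (t `\ n)%fset)) => //.
  + by apply: measurable_funM; apply: noise_prod_measurable; exact: noise_prod_below.
  + by rewrite sE; exact: noise_prodM_integrable.
  + rewrite (_ : _ \* cst 1 = Zs (s `\ n)%fset \* Zs (t `\ n)%fset).
      exact: noise_prodM_integrable.
    by apply/funext => x /=; rewrite mulr1.
- exact: noise_prod_orthogonal1 ns nt.
- under eq_Rintegral do rewrite mulrC.
  exact: noise_prod_orthogonal1 nt ns.
- by apply: IH st; exact: noise_prod_below1.
Qed.

End noise_products.

Section square_integrable_functions.
Context d (T : measurableType d) (R : realType) (P : probability T R).
Variable Z : normal_noise P.
Local Notation C := R[i].
Local Notation F := (g_sigma_algebraType (noise_events Z setT)).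

(* complex-valued, measurable for F_infty = <<s noise_events Z setT >>, with
   square-integrable modulus *)
Definition square_integrable : {pred T -> C} := mem [set f : T -> C |
  [/\ measurable_fun setT (fun x : F => complex.Re (f x)),
      measurable_fun setT (fun x : F => complex.Im (f x)) &
      (\int[P]_x (Normc.normc (f x) ^+ 2)%:E < +oo)%E]].

Definition real_square_integrable (f : T -> R) : Prop :=
  measurable_fun setT (f : F -> R) /\ (\int[P]_x (f x ^+ 2)%:E < +oo)%E.

Lemma noise_measurableT (f : T -> R) :
  measurable_fun setT (f : F -> R) -> measurable_fun setT f.
Proof. exact: (sub_sigma_measurable_fun (@noise_events_measurable _ _ _ _ Z setT)). Qed.

Lemma normc2E (z : C) : Normc.normc z ^+ 2 = complex.Re z ^+ 2 + complex.Im z ^+ 2.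
Proof. by case: z => a b /=; rewrite sqr_sqrtr// addr_ge0 ?sqr_ge0. Qed.

Lemma measurable_sqr_EFin (f : T -> R) :
  measurable_fun setT (f : F -> R) -> measurable_fun setT (fun x => (f x ^+ 2)%:E).
Proof.
by move=> mf; apply/measurable_EFinP; apply: measurable_funX; exact: noise_measurableT.
Qed.

Lemma square_integrableP (f : T -> C) : f \in square_integrable <->
  real_square_integrable (fun x => complex.Re (f x)) /\
  real_square_integrable (fun x => complex.Im (f x)).
Proof.
have e : measurable_fun setT (fun x : F => complex.Re (f x)) ->
    measurable_fun setT (fun x : F => complex.Im (f x)) ->
  (\int[P]_x (Normc.normc (f x) ^+ 2)%:E =
   \int[P]_x (complex.Re (f x) ^+ 2)%:E + \int[P]_x (complex.Im (f x) ^+ 2)%:E)%E.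
  move=> mr mi; rewrite -ge0_integralD//; last 4 first.
  - by move=> x _; rewrite lee_fin sqr_ge0.
  - exact: measurable_sqr_EFin.
  - by move=> x _; rewrite lee_fin sqr_ge0.
  - exact: measurable_sqr_EFin.
  by apply: eq_integral => x _; rewrite normc2E EFinD.
split.
  rewrite inE/= => -[mr mi]; rewrite e// => foo.
  split; split => //; apply: le_lt_trans foo.
    by rewrite leeDl// integral_ge0// => x _; rewrite lee_fin sqr_ge0.
  by rewrite leeDr// integral_ge0// => x _; rewrite lee_fin sqr_ge0.
move=> [[mr rr] [mi ii]]; rewrite inE/=; split => //.
by rewrite e// lte_add_pinfty.
Qed.

Lemma real_square_integrable_linear (a b : R) (f g : T -> R) :
  real_square_integrable f -> real_square_integrable g ->
  real_square_integrable (fun x => a * f x + b * g x).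
Proof.
move=> [mf f2] [mg g2].
have mfg : measurable_fun setT ((fun x => a * f x + b * g x) : F -> R).
  by apply: measurable_funD; exact: measurable_funM.
split => //.
have mf' := measurable_sqr_EFin mf; have mg' := measurable_sqr_EFin mg.
apply: (@le_lt_trans _ _ (\int[P]_x ((2 * a ^+ 2)%:E * (f x ^+ 2)%:E +
    (2 * b ^+ 2)%:E * (g x ^+ 2)%:E))%E).
  apply: ge0_le_integral => //.
  - by move=> x _; rewrite lee_fin sqr_ge0.
  - exact: measurable_sqr_EFin.
  - by apply: emeasurable_funD; exact: measurable_funeM.
  move=> x _; rewrite -!EFinM -EFinD lee_fin.
  rewrite -subr_ge0 (_ : _ - _ = (a * f x - b * g x) ^+ 2); first exact: sqr_ge0.
  by ring.
have c0 (c : R) : 0 <= 2 * c ^+ 2 by rewrite mulr_ge0// sqr_ge0.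
have sq0 (h : T -> R) x : setT x -> (0 <= (h x ^+ 2)%:E)%E.
  by move=> _; rewrite lee_fin sqr_ge0.
have csq0 (c : R) (h : T -> R) x : setT x -> (0 <= (2 * c ^+ 2)%:E * (h x ^+ 2)%:E)%E.
  by move=> _; rewrite mule_ge0// lee_fin// sqr_ge0.
rewrite ge0_integralD//; last 4 first.
- exact: csq0.
- exact: measurable_funeM.
- exact: csq0.
- exact: measurable_funeM.
rewrite !ge0_integralZl_EFin//; [|exact: sq0|exact: sq0].
by rewrite lte_add_pinfty// lte_mul_pinfty// lee_fin.
Qed.

Lemma real_square_integrable0 : real_square_integrable (cst 0).
Proof.
split; first exact: measurable_cst.
by under eq_integral do rewrite expr0n; rewrite integral0 ltry.
Qed.

Lemma square_integrable_submod_closed : submod_closed square_integrable.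
Proof.
split.
  by apply/square_integrableP; split; exact: real_square_integrable0.
move=> a f g /square_integrableP[rf jf] /square_integrableP[rg jg].
have -> : a *: f + g = (fun x => (complex.Re a * complex.Re (f x) - complex.Im a * complex.Im (f x) + complex.Re (g x)) +i*
                              (complex.Re a * complex.Im (f x) + complex.Im a * complex.Re (f x) + complex.Im (g x)))%C.
  apply/funext => x; rewrite /GRing.add/= /GRing.scale/=.
  by case: a (f x) (g x) => [a b] [c e] [u v].
apply/square_integrableP; split => /=.
  have := real_square_integrable_linear 1 1
    (real_square_integrable_linear (complex.Re a) (- complex.Im a) rf jf) rg.
  by congr real_square_integrable; apply/funext => x; rewrite !mul1r mulNr.
have := real_square_integrable_linear 1 1
  (real_square_integrable_linear (complex.Re a) (complex.Im a) jf rf) jg.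
by congr real_square_integrable; apply/funext => x; rewrite !mul1r.
Qed.

HB.instance Definition _ := GRing.isSubmodClosed.Build C (T -> C)
  square_integrable square_integrable_submod_closed.

Record sqfun := SqFun {
  sqfun_val :> T -> C ;
  sqfun_in : sqfun_val \in square_integrable }.

HB.instance Definition _ := [isSub for sqfun_val].
HB.instance Definition _ := [Choice of sqfun by <:].
HB.instance Definition _ := [SubChoice_isSubLmodule of sqfun by <:].

End square_integrable_functions.

Section L2_space.
Context d (T : measurableType d) (R : realType) (P : probability T R).
Variable Z : normal_noise P.
Local Notation C := R[i].

Definition null_sqfun : {pred sqfun Z} :=
  mem [set f : sqfun Z | {ae P, forall x, f x = 0}].

Lemma null_sqfun_zmod_closed : zmod_closed null_sqfun.
Proof.
split; first by rewrite inE/=; apply: aeW => x.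
move=> f g; rewrite !inE/= => f0 g0.
by apply: filterS2 f0 g0 => x /= f0 g0; rewrite -[LHS]/(f x - g x) f0 g0 subr0.
Qed.

HB.instance Definition _ := GRing.isZmodClosed.Build (sqfun Z) null_sqfun
  null_sqfun_zmod_closed.

(* classes of F_infty-measurable square-integrable functions modulo P-almost
   everywhere equality *)
Definition L2 : Type := Quotient.quot null_sqfun.

HB.instance Definition _ := GRing.Zmodule.on L2.
HB.instance Definition _ := EqQuotient.on L2.

Local Open Scope quotient_scope.

Definition L2_class (f : sqfun Z) : L2 := \pi_L2 f.

Lemma L2_classP (f g : sqfun Z) :
  L2_class f = L2_class g <-> {ae P, forall x, f x = g x}.
Proof.
rewrite /L2_class; split => [/eqP|fg].
  rewrite -Quotient.idealrBE inE/=; apply: filterS => x /eqP.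
  by rewrite -[X in X == _]/(f x - g x) subr_eq0 => /eqP.
apply/eqP; rewrite -Quotient.idealrBE inE/=; apply: filterS fg => x /= fg.
by rewrite -[LHS]/(f x - g x) fg subrr.
Qed.

Lemma L2_classD f g : L2_class (f + g) = L2_class f + L2_class g.
Proof. by rewrite /L2_class !piE. Qed.

Lemma L2_reprK (u : L2) : L2_class (repr u) = u.
Proof. exact: reprK. Qed.

Definition L2_scale (a : C) (u : L2) : L2 := L2_class (a *: repr u).

Lemma L2_scaleE a f : L2_scale a (L2_class f) = L2_class (a *: f).
Proof.
apply/L2_classP; have /L2_classP := L2_reprK (L2_class f).
by apply: filterS => x /= e; rewrite -[LHS]/(a * repr (L2_class f) x) e.
Qed.

Lemma L2_scaleA a b u : L2_scale a (L2_scale b u) = L2_scale (a * b) u.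
Proof. by rewrite -[u]L2_reprK !L2_scaleE scalerA. Qed.

Lemma L2_scale1 : left_id 1 L2_scale.
Proof. by move=> u; rewrite -[u]L2_reprK !L2_scaleE scale1r. Qed.

Lemma L2_scaleDr : right_distributive L2_scale +%R.
Proof.
move=> a u v; rewrite -[u]L2_reprK -[v]L2_reprK.
by rewrite -L2_classD !L2_scaleE scalerDr L2_classD.
Qed.

Lemma L2_scaleDl u : {morph L2_scale^~ u : a b / a + b}.
Proof.
by move=> a b; rewrite -[u]L2_reprK !L2_scaleE scalerDl L2_classD.
Qed.

HB.instance Definition _ := GRing.Zmodule_isLmodule.Build C L2
  L2_scaleA L2_scale1 L2_scaleDr L2_scaleDl.

Definition complex_integral (f : T -> C) : C :=
  ((\int[P]_x complex.Re (f x)) +i* (\int[P]_x complex.Im (f x)))%C.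

Definition L2_dot (u v : L2) : C :=
  complex_integral (fun x => (repr u x)^*%C * repr v x).

Definition L2_norm (u : L2) : R := Num.sqrt (complex.Re (L2_dot u u)).

Definition real_dot (f g : T -> R) : R := \int[P]_x (f x * g x).

Lemma complex_dotE (f g : sqfun Z) :
  complex_integral (fun x => (f x)^*%C * g x) =
  ((real_dot (fun x => complex.Re (f x)) (fun x => complex.Re (g x)) +
    real_dot (fun x => complex.Im (f x)) (fun x => complex.Im (g x))) +i*
   (real_dot (fun x => complex.Re (f x)) (fun x => complex.Im (g x)) -
    real_dot (fun x => complex.Im (f x)) (fun x => complex.Re (g x))))%C.
Proof.
have /square_integrableP[[mrf rf] [mjf jf]] := sqfun_in f.
have /square_integrableP[[mrg rg] [mjg jg]] := sqfun_in g.
have mm h := @noise_measurableT _ _ _ _ Z h.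
rewrite /complex_integral /real_dot; congr (_ +i* _)%C.
  rewrite -RintegralD//; last 2 first.
  - by apply: integrable_mul_sqr => //; exact: mm.
  - by apply: integrable_mul_sqr => //; exact: mm.
  by apply: eq_Rintegral => x _; case: (f x) (g x) => [a b] [c e] /=; rewrite mulNr opprK.
rewrite -RintegralB//; last 2 first.
- by apply: integrable_mul_sqr => //; exact: mm.
- by apply: integrable_mul_sqr => //; exact: mm.
by apply: eq_Rintegral => x _; case: (f x) (g x) => [a b] [c e] /=; rewrite mulNr.
Qed.

Lemma real_dot_linear (a b : R) (f g h : T -> R) :
  real_square_integrable Z f -> real_square_integrable Z g ->
  real_square_integrable Z h ->
  real_dot f (fun x => a * g x + b * h x) = a * real_dot f g + b * real_dot f h.
Proof.
move=> [mf f2] [mg g2] [mh h2]; rewrite /real_dot.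
have mm u := @noise_measurableT _ _ _ _ Z u.
have ifg : P.-integrable setT (EFin \o (fun x => f x * g x)).
  by apply: integrable_mul_sqr => //; exact: mm.
have ifh : P.-integrable setT (EFin \o (fun x => f x * h x)).
  by apply: integrable_mul_sqr => //; exact: mm.
rewrite -!RintegralZl// -RintegralD//; last 2 first.
- exact: (integrableZl measurableT a ifg).
- exact: (integrableZl measurableT b ifh).
by apply: eq_Rintegral => x _; rewrite mulrDr !(mulrCA (f x)).
Qed.

Lemma real_dot_ae (f g f' g' : T -> R) :
  real_square_integrable Z f -> real_square_integrable Z g ->
  real_square_integrable Z f' -> real_square_integrable Z g' ->
  {ae P, forall x, f x = f' x} -> {ae P, forall x, g x = g' x} ->
  real_dot f g = real_dot f' g'.
Proof.
move=> [mf _] [mg _] [mf' _] [mg' _] ff' gg'; congr fine.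
apply: ae_eq_integral => //.
- by apply/measurable_EFinP; apply: measurable_funM; exact: (@noise_measurableT _ _ _ _ Z).
- by apply/measurable_EFinP; apply: measurable_funM; exact: (@noise_measurableT _ _ _ _ Z).
by apply: filterS2 ff' gg' => x /= -> ->.
Qed.

Lemma L2_dotE (f g : sqfun Z) :
  L2_dot (L2_class f) (L2_class g) =
  complex_integral (fun x => (f x)^*%C * g x).
Proof.
rewrite /L2_dot !complex_dotE.
have ae h : {ae P, forall x, repr (L2_class h) x = h x}.
  by apply/L2_classP; exact: L2_reprK.
have aer h : {ae P, forall x, complex.Re (repr (L2_class h) x) = complex.Re (h x)}.
  by apply: filterS (ae h) => x /= ->.
have aei h : {ae P, forall x, complex.Im (repr (L2_class h) x) = complex.Im (h x)}.
  by apply: filterS (ae h) => x /= ->.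
have sr (h : sqfun Z) : real_square_integrable Z (fun x => complex.Re (h x)).
  by have /square_integrableP[] := sqfun_in h.
have si (h : sqfun Z) : real_square_integrable Z (fun x => complex.Im (h x)).
  by have /square_integrableP[] := sqfun_in h.
congr Complex; [congr (_ + _)|congr (_ - _)]; exact: real_dot_ae.
Qed.

Lemma L2_dot_linear (u : L2) : linear_for *%R (L2_dot u).
Proof.
move=> a v w; rewrite -[u]L2_reprK -[v]L2_reprK -[w]L2_reprK.
move: (repr u) (repr v) (repr w) => f g h.
rewrite -[a *: L2_class g]/(L2_scale _ _) L2_scaleE -L2_classD !L2_dotE !complex_dotE.
have sr (k : sqfun Z) : real_square_integrable Z (fun x => complex.Re (k x)).
  by have /square_integrableP[] := sqfun_in k.
have si (k : sqfun Z) : real_square_integrable Z (fun x => complex.Im (k x)).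
  by have /square_integrableP[] := sqfun_in k.
have -> : (fun x => complex.Re ((a *: g + h : sqfun Z) x)) =
    (fun x => 1 * (complex.Re a * complex.Re (g x) + (- complex.Im a) * complex.Im (g x)) +
      1 * complex.Re (h x)).
  apply/funext => x; rewrite -[(a *: g + h : sqfun Z) x]/(a * g x + h x).
  by case: a (g x) (h x) => [a b] [c e] [p q] /=; rewrite !mul1r mulNr.
have -> : (fun x => complex.Im ((a *: g + h : sqfun Z) x)) =
    (fun x => 1 * (complex.Re a * complex.Im (g x) + complex.Im a * complex.Re (g x)) +
      1 * complex.Im (h x)).
  apply/funext => x; rewrite -[(a *: g + h : sqfun Z) x]/(a * g x + h x).
  by case: a (g x) (h x) => [a b] [c e] [p q] /=; rewrite !mul1r.
rewrite !real_dot_linear//; try exact: real_square_integrable_linear.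
set rr := real_dot _ _; set ri := real_dot _ _; set rrh := real_dot _ _.
case: a => a b /=.
apply/eqP; rewrite eq_complex /=; apply/andP; split; apply/eqP; ring.
Qed.

Lemma noise_prod_square_integrable (s : {fset nat}) :
  (fun x => (noise_prod Z s x)%:C%C) \in square_integrable Z.
Proof.
apply/square_integrableP; split; last exact: real_square_integrable0.
split; first exact: noise_prod_measurable.
exact: noise_prod_sqr_lty.
Qed.

Definition noise_basis (s : {fset nat}) : L2 :=
  L2_class (SqFun (noise_prod_square_integrable s)).

Lemma noise_basis_orthogonal (s t : {fset nat}) : s != t ->
  L2_dot (noise_basis s) (noise_basis t) = 0.
Proof.
move=> st; rewrite L2_dotE complex_dotE /= /real_dot noise_prod_orthogonal//.
have i0 (f : T -> R) : f =1 cst 0 -> \int[P]_x f x = 0.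
  by move=> f0; rewrite (_ : f = cst 0) ?Rintegral_cst ?mul0r//; exact/funext.
by rewrite !i0 ?addr0 ?subr0// => x /=; rewrite ?mulr0 ?mul0r.
Qed.

End L2_space.

Arguments complex_integral : simpl never.
Arguments L2_dot : simpl never.

Section test_space.
Context d (T : measurableType d) (R : realType) (P : probability T R).
Variable Z : normal_noise P.
Local Notation C := R[i].
Local Notation coef s u := (L2_dot (noise_basis Z s) u).

(* totality in L2(Z): finite linear combinations of the Z_s are dense *)
Definition chaotic_representation : Prop :=
  forall (u : L2 Z) (e : R), 0 < e ->
    exists (A : {fset {fset nat}}) (c : {fset nat} -> C),
      L2_norm (u - \sum_(s <- A) c s *: noise_basis Z s) < e.

Definition weight (s : {fset nat}) : R := \prod_(k <- s) k.+1%:R.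

Definition Sp_sqnorm (p : R) (u : L2 Z) : \bar R :=
  \esum_(s in [set: {fset nat}])
    (weight s `^ (2 * p) * Normc.normc (coef s u) ^+ 2)%:E.

Definition Sp (p : R) : set (L2 Z) := [set u | (Sp_sqnorm p u < +oo)%E].

Definition Sp_norm (p : R) (u : L2 Z) : R := Num.sqrt (fine (Sp_sqnorm p u)).

Definition test_pred : {pred L2 Z} := mem (\bigcap_(p in [set p | 0 <= p]) Sp p).

Lemma esum_mulr_le (I : choiceType) (k : R) (a : I -> R) :
  0 <= k -> (forall i, 0 <= a i) ->
  (\esum_(i in [set: I]) (k * a i)%:E <= k%:E * \esum_(i in [set: I]) (a i)%:E)%E.
Proof.
move=> k0 a0; apply: ge_ereal_sup => _ [A [finA _] <-].
under eq_fsbigr do rewrite EFinM.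
rewrite -ge0_mule_fsumr; last by move=> i; rewrite lee_fin.
apply: lee_wpmul2l; first by rewrite lee_fin.
by apply: ereal_sup_ubound; exists A.
Qed.

Lemma coef_linear s : linear_for *%R (fun u : L2 Z => coef s u).
Proof. exact: L2_dot_linear. Qed.

Lemma coef0 s : coef s 0 = 0.
Proof.
by have := coef_linear s (-1) 0 0; rewrite scaler0 addr0 mulN1r addNr.
Qed.

Lemma normc2D (a x y : C) :
  Normc.normc (a * x + y) ^+ 2 <=
  2 * Normc.normc a ^+ 2 * Normc.normc x ^+ 2 + 2 * Normc.normc y ^+ 2.
Proof.
rewrite -mulrA -exprMn -Normc.normcM !normc2E.
set z := a * x; case: z y => [u v] [w t] /=.
rewrite -subr_ge0 (_ : _ - _ = (u - w) ^+ 2 + (v - t) ^+ 2); last by ring.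
by rewrite addr_ge0// sqr_ge0.
Qed.

Lemma test_predP u : u \in test_pred <-> forall p, 0 <= p -> (Sp_sqnorm p u < +oo)%E.
Proof. by split => [/set_mem|uS]; [|exact/mem_set]. Qed.

Lemma test_submod_closed : submod_closed test_pred.
Proof.
split.
  apply/test_predP => p p0; rewrite /Sp_sqnorm esum1 ?ltry// => s _.
  by rewrite coef0 Normc.normc0 expr0n mulr0.
move=> a u v /test_predP uS /test_predP vS; apply/test_predP => p p0.
have := uS _ p0; have := vS _ p0; rewrite /Sp_sqnorm => vp up.
set fu := (fun s => weight s `^ (2 * p) * Normc.normc (coef s u) ^+ 2) in up *.
set fv := (fun s => weight s `^ (2 * p) * Normc.normc (coef s v) ^+ 2) in vp *.
have fu0 s : 0 <= fu s by rewrite mulr_ge0 ?powR_ge0 ?sqr_ge0.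
have fv0 s : 0 <= fv s by rewrite mulr_ge0 ?powR_ge0 ?sqr_ge0.
have k0 : 0 <= 2 * Normc.normc a ^+ 2 by rewrite mulr_ge0// sqr_ge0.
apply: (@le_lt_trans _ _ (\esum_(s in [set: {fset nat}])
    ((2 * Normc.normc a ^+ 2 * fu s)%:E + (2 * fv s)%:E))%E).
  apply: le_esum => s _; rewrite -EFinD lee_fin coef_linear.
  rewrite /fu /fv !(mulrCA _ (weight s `^ (2 * p))) -mulrDr.
  by rewrite ler_wpM2l ?powR_ge0// normc2D.
rewrite esumD; last 2 first.
- by move=> s _; rewrite lee_fin mulr_ge0.
- by move=> s _; rewrite lee_fin mulr_ge0.
rewrite lte_add_pinfty//.
  apply: (le_lt_trans (esum_mulr_le k0 fu0)).
  by apply: lte_mul_pinfty; rewrite ?lee_fin.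
apply: (le_lt_trans (esum_mulr_le _ fv0)) => //.
by apply: lte_mul_pinfty; rewrite ?lee_fin.
Qed.

HB.instance Definition _ := GRing.isSubmodClosed.Build C (L2 Z) test_pred
  test_submod_closed.

(* S(Z), the intersection of the S_p(Z), p >= 0 *)
Record test_space := TestSpace {
  test_val :> L2 Z ;
  test_in : test_val \in test_pred }.

HB.instance Definition _ := [isSub for test_val].
HB.instance Definition _ := [Choice of test_space by <:].
HB.instance Definition _ := [SubChoice_isSubLmodule of test_space by <:].
HB.instance Definition _ := isPointed.Build test_space 0.

(* topology generated by the open balls of all the norms of index p >= 0 *)
HB.instance Definition _ := @isSubBaseTopological.Build test_space
  (R * test_space * R)%type
  [set q | 0 <= q.1.1 /\ 0 < q.2]
  (fun q => [set u : test_space | Sp_norm q.1.1 (test_val (u - q.1.2)) < q.2]).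

Lemma noise_basis_test s : noise_basis Z s \in test_pred.
Proof.
apply/test_predP => p _; rewrite /Sp_sqnorm.
have f0 t : 0 <= weight t `^ (2 * p) * Normc.normc (coef t (noise_basis Z s)) ^+ 2.
  by rewrite mulr_ge0 ?powR_ge0 ?sqr_ge0.
rewrite (esumID [set s]); last by move=> t _; rewrite lee_fin.
rewrite !setTI esum_set1 ?lee_fin//.
rewrite esum1 ?adde0 ?ltry// => t /eqP ts.
by rewrite noise_basis_orthogonal// Normc.normc0 expr0n mulr0.
Qed.

Definition test_basis (s : {fset nat}) : test_space := TestSpace (noise_basis_test s).

End test_space.

Arguments Sp_sqnorm : simpl never.
Arguments Sp_norm : simpl never.

Section strong_dual.
Context (K : numFieldType) (E : preTopologicalLmodType K).

Definition absorbed_bounded (B : set E) : Prop :=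
  forall U : set E, nbhs (0 : E) U ->
    exists2 r : K, 0 < r &
      forall t : K, r <= `|t| -> B `<=` [set t *: x | x in U].

Definition continuous_functional : {pred E -> K^o} :=
  mem [set f : E -> K^o | linear f /\ continuous f].

Lemma continuous_functional_submod_closed : submod_closed continuous_functional.
Proof.
split.
  rewrite inE/=; split; last by move=> x; exact: cvg_cst.
  by move=> a u v /=; rewrite scaler0 addr0.
move=> a f g; rewrite !inE/= => -[lf cf] [lg cg]; split.
  move=> b u v.
  rewrite -[LHS]/(a *: f (b *: u + v) + g (b *: u + v)) lf lg.
  rewrite -[RHS]/(b *: (a *: f u + g u) + (a *: f v + g v)).
  by rewrite !scalerDr !scalerA (mulrC a b) addrACA.
move=> x; apply: cvgD; last exact: cg.
by apply: cvgZr; exact: cf.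
Qed.

HB.instance Definition _ := GRing.isSubmodClosed.Build K (E -> K^o)
  continuous_functional continuous_functional_submod_closed.

(* the dual of E with the topology of uniform convergence on bounded subsets *)
Record strong_dual := StrongDual {
  functional :> E -> K^o ;
  functional_in : functional \in continuous_functional }.

HB.instance Definition _ := [isSub for functional].
HB.instance Definition _ := [Choice of strong_dual by <:].
HB.instance Definition _ := [SubChoice_isSubLmodule of strong_dual by <:].
HB.instance Definition _ := Uniform.copy strong_dual
  (initial_topology
    (functional : strong_dual -> {family absorbed_bounded, E -> K^o})).

End strong_dual.

Section fock.
Context d (T : measurableType d) (R : realType) (P : probability T R).
Variable Z : normal_noise P.

Definition fock_transform (Phi : strong_dual (test_space Z)) (s : {fset nat}) :
  R[i] := Phi (test_basis Z s).

End fock.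

(* Main.v *)
Require Import Defs.
From HB Require Import structures.
From mathcomp Require Import all_boot all_order all_algebra finmap complex.
From mathcomp Require Import all_classical all_reals all_analysis measurable_realfun.
From mathcomp Require Import ring.
Set Implicit Arguments. Unset Strict Implicit. Unset Printing Implicit Defensive.
Import Order.TTheory GRing.Theory Num.Theory numFieldNormedType.Exports.
Local Open Scope classical_set_scope. Local Open Scope ring_scope.

(* The transpose of a_k is the creation operator Z_s |-> [k \notin s] Z_(s U k),
   which multiplies ||.||_p by at most (k+1)^p.  It is never built on S(Z), which
   would require the completeness of S(Z): with b_n its truncation to the sets
   s U k contained in {0, ..., n-1}, the sequence (b_n u) is Cauchy for every norm and
   (a_k Phi)(u) is the limit of Phi(b_n u).  Strong continuity holds because
   the union of the images b_n(B) of a bounded set B is bounded. *)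

(** * Orthonormality of the Z_s and coefficients of finite combinations *)

Section noise_basis_norm.
Context d (T : measurableType d) (R : realType) (P : probability T R).
Variable Z : normal_noise P.

(** Induction on a strict bound n of s. The other factors are measurable for F_(n-1), so the top
    factor Z_n^2 may be replaced by its conditional expectation 1. *)
Lemma noise_prod_sqr_integral (s : {fset nat}) :
  (\int[P]_x ((noise_prod Z s x) ^+ 2)%:E = 1)%E.
Proof.
have [n sn] : exists n, forall i, i \in s -> (i < n)%N.
  exists (\max_(i <- s) i).+1 => i si; rewrite ltnS.
  by rewrite (big_fsetD1 i)//= leq_maxl.
elim: n s sn => [s s0|n IH s sn].
  rewrite (_ : s = fset0); last first.
    by apply/fsetP => i; rewrite inE; apply/negbTE/negP => /s0.
  under eq_integral do rewrite /noise_prod big_seq_fset0 expr1n.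
  by rewrite integral_cst// mul1e; exact: probability_setT.
have [ns|ns] := boolP (n \in s); last by apply: IH; exact: noise_prod_below1 ns.
have sn' := noise_prod_below sn; rewrite -[RHS](IH _ sn').
have [_ _ _ vn] := noise_variance Z n.
rewrite (noise_prodD1 Z ns).
under eq_integral do rewrite exprMn mulrC.
under [RHS]eq_integral do rewrite -[X in X%:E]mulr1.
apply: (@ge0_integral_weighted _ _ _ _ _ (@noise_events_measurable _ _ _ _ Z `I_n)
  (fun x => Z n x ^+ 2) (cst 1) (fun x => noise_prod Z (s `\ n)%fset x ^+ 2)) => //.
- by apply: measurable_funX; exact: measurable_funP.
- by move=> x; exact: sqr_ge0.
- by apply: measurable_funX; exact: noise_prod_measurable.
- by move=> x; exact: sqr_ge0.
Qed.

Lemma noise_basis_unit (s : {fset nat}) :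
  L2_dot (noise_basis Z s) (noise_basis Z s) = 1.
Proof.
rewrite L2_dotE complex_dotE /= /real_dot.
have i0 (f : T -> R) : f =1 cst 0 -> \int[P]_x f x = 0.
  by move=> f0; rewrite (_ : f = cst 0) ?Rintegral_cst ?mul0r//; exact/funext.
have -> : \int[P]_x (noise_prod Z s x * noise_prod Z s x) = 1.
  rewrite /Rintegral -[RHS]/(fine 1%E) -(noise_prod_sqr_integral s).
  by congr fine; apply: eq_integral => x _; rewrite expr2.
by rewrite !i0 ?addr0 ?subr0// => x /=; rewrite ?mulr0 ?mul0r.
Qed.

Lemma noise_basis_dot (s t : {fset nat}) :
  L2_dot (noise_basis Z s) (noise_basis Z t) = (s == t)%:R.
Proof.
by have [->|/noise_basis_orthogonal ->//] := eqVneq s t; exact: noise_basis_unit.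
Qed.

Lemma coefZD (s : {fset nat}) (a : R[i]) (u v : L2 Z) :
  L2_dot (noise_basis Z s) (a *: u + v) =
  a * L2_dot (noise_basis Z s) u + L2_dot (noise_basis Z s) v.
Proof. exact: coef_linear. Qed.

Lemma coefZ (s : {fset nat}) (a : R[i]) (u : L2 Z) :
  L2_dot (noise_basis Z s) (a *: u) = a * L2_dot (noise_basis Z s) u.
Proof. by rewrite -[a *: u]addr0 coefZD Defs.coef0 addr0. Qed.

Lemma coef_sum (s : {fset nat}) (A : seq {fset nat}) (f : {fset nat} -> L2 Z) :
  L2_dot (noise_basis Z s) (\sum_(t <- A) f t) =
  \sum_(t <- A) L2_dot (noise_basis Z s) (f t).
Proof.
elim/big_rec2: _ => [|t x y _ <-]; first exact: Defs.coef0.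
by rewrite -[f t]scale1r coefZD mul1r scale1r.
Qed.

Lemma coef_combination (A : {fset {fset nat}}) (c : {fset nat} -> R[i]) s :
  L2_dot (noise_basis Z s) (\sum_(t <- A) c t *: noise_basis Z t) =
  if s \in A then c s else 0.
Proof.
rewrite coef_sum; under eq_bigr do rewrite coefZ noise_basis_dot.
case: ifPn => sA.
  rewrite (big_fsetD1 s)//= eqxx mulr1 big_seq big1 ?addr0// => t.
  by rewrite !inE => /andP[/negbTE ts _]; rewrite eq_sym ts mulr0.
rewrite big_seq big1// => t tA; case: eqP => [st|]; last by rewrite mulr0.
by rewrite st tA in sA.
Qed.

End noise_basis_norm.

(** * The weighted norms ||.||_p on S(Z) *)

Section Sp_seminorms.
Context d (T : measurableType d) (R : realType) (P : probability T R).
Variable Z : normal_noise P.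
Local Notation coef s u := (L2_dot (noise_basis Z s) u).
Local Notation wterm p u s :=
  (weight R s `^ (2 * p) * Normc.normc (coef s u) ^+ 2).
Implicit Types (p : R) (u v : test_space Z) (a : R[i]).

Lemma weight_ge1 (s : {fset nat}) : 1 <= weight R s.
Proof.
rewrite /weight; elim/big_ind: _ => [//|x y x1 y1|i _]; first exact: mulr_ege1.
by rewrite ler1n.
Qed.

Lemma weightU1 k (s : {fset nat}) : k \notin s ->
  weight R (k |` s)%fset = k.+1%:R * weight R s.
Proof. by move=> ks; rewrite /weight big_fsetU1. Qed.

Lemma wterm_ge0 p (u : L2 Z) (s : {fset nat}) : 0 <= wterm p u s.
Proof. by rewrite mulr_ge0 ?powR_ge0 ?sqr_ge0. Qed.

Lemma Sp_sqnorm_esum p (u : L2 Z) :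
  Sp_sqnorm p u = \esum_(s in [set: {fset nat}]) (wterm p u s)%:E.
Proof. by []. Qed.

Lemma Sp_sqnorm_ge0 p (u : L2 Z) : (0 <= Sp_sqnorm p u)%E.
Proof. by apply: esum_ge0 => s _; rewrite lee_fin wterm_ge0. Qed.

Lemma Sp_norm_ge0 p (u : L2 Z) : 0 <= Sp_norm p u.
Proof. exact: sqrtr_ge0. Qed.

Lemma Sp_sqnormE p u : 0 <= p -> Sp_sqnorm p u = (Sp_norm p u ^+ 2)%:E.
Proof.
move=> p0; have /test_predP/(_ _ p0) up := test_in u.
rewrite sqr_sqrtr ?fine_ge0 ?Sp_sqnorm_ge0// fineK//.
by rewrite ge0_fin_numE ?Sp_sqnorm_ge0.
Qed.

(* Otherwise unifying the norms of distinct vectors unfolds them down to integrals. *)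
#[local] Opaque Sp_norm Sp_sqnorm.

Lemma Sp_norm_leP p u (c : R) : 0 <= p -> 0 <= c ->
  (Sp_norm p u <= c) = (Sp_sqnorm p u <= (c ^+ 2)%:E)%E.
Proof.
move=> p0 c0; rewrite Sp_sqnormE// lee_fin.
by rewrite ler_pXn2r// nnegrE// Sp_norm_ge0.
Qed.

(** Every weight is at least 1, so its powers increase with the exponent. This makes the family of
    norms directed. *)
Lemma Sp_norm_mono p q u : 0 <= p -> p <= q -> Sp_norm p u <= Sp_norm q u.
Proof.
move=> p0 pq; have q0 := le_trans p0 pq.
rewrite Sp_norm_leP ?Sp_norm_ge0// -Sp_sqnormE// !Sp_sqnorm_esum; apply: le_esum => s _.
rewrite lee_fin ler_wpM2r ?sqr_ge0// ler_powR ?weight_ge1//.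
by rewrite ler_wpM2l.
Qed.

Lemma Sp_normZ_le p a u : 0 <= p ->
  Sp_norm p (a *: u : test_space Z) <= Normc.normc a * Sp_norm p u.
Proof.
move=> p0; have na : 0 <= Normc.normc a by case: (a) => x y; exact: sqrtr_ge0.
rewrite Sp_norm_leP ?mulr_ge0 ?Sp_norm_ge0//.
rewrite exprMn EFinM -Sp_sqnormE// !Sp_sqnorm_esum.
apply: le_trans (esum_mulr_le (sqr_ge0 (Normc.normc a)) (wterm_ge0 p u)).
apply: le_esum => s _.
rewrite -[test_val (a *: u)]/(a *: test_val u) coefZ Normc.normcM exprMn.
by rewrite mulrCA.
Qed.

(* Young's inequality with a free parameter; its optimization gives Minkowski's
   inequality for the weighted l2 norm. *)
Lemma normcD_sqr_le (x y : R[i]) (e : R) : 0 < e ->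
  Normc.normc (x + y) ^+ 2 <=
  (1 + e) * Normc.normc x ^+ 2 + (1 + e^-1) * Normc.normc y ^+ 2.
Proof.
move=> e0; rewrite !normc2E; case: x y => [a b] [c f] /=.
rewrite -subr_ge0 (_ : _ - _ = e^-1 * ((e * a - c) ^+ 2 + (e * b - f) ^+ 2)).
  by rewrite mulr_ge0 ?invr_ge0 ?(ltW e0)// addr_ge0// sqr_ge0.
by field; rewrite gt_eqF.
Qed.

Lemma esum_combination_le (I : choiceType) (x y : R) (f g h : I -> R) :
  0 <= x -> 0 <= y -> (forall i, 0 <= f i) -> (forall i, 0 <= g i) ->
  (forall i, h i <= x * f i + y * g i) ->
  (\esum_(i in [set: I]) (h i)%:E <=
   x%:E * (\esum_(i in [set: I]) (f i)%:E) + y%:E * \esum_(i in [set: I]) (g i)%:E)%E.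
Proof.
move=> x0 y0 f0 g0 hfg.
apply: (le_trans _ (leeD (esum_mulr_le x0 f0) (esum_mulr_le y0 g0))).
rewrite -esumD => [|i _|i _]; last 2 first.
- by rewrite lee_fin mulr_ge0.
- by rewrite lee_fin mulr_ge0.
by apply: le_esum => i _; rewrite -EFinD lee_fin.
Qed.

Lemma Sp_sqnormD_le p u v (e : R) : 0 < e ->
  (Sp_sqnorm p (u + v : test_space Z)%R <=
   (1 + e)%:E * Sp_sqnorm p u + (1 + e^-1)%:E * Sp_sqnorm p v)%E.
Proof.
move=> e0; rewrite !Sp_sqnorm_esum; apply: esum_combination_le.
- by rewrite addr_ge0// ltW.
- by rewrite addr_ge0// invr_ge0 ltW.
- exact: wterm_ge0.
- exact: wterm_ge0.
move=> s; rewrite -[test_val (u + v)]/(test_val u + test_val v).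
rewrite !(mulrCA _ (_ `^ _)) -mulrDr ler_wpM2l ?powR_ge0//.
by rewrite -[test_val u]scale1r coefZD mul1r scale1r; exact: normcD_sqr_le.
Qed.

(** The bound is least at e = y / x, where it equals (x + y)^2. *)
Lemma le_add_of_sqr_le (x y z : R) : 0 <= x -> 0 <= y -> 0 <= z ->
  (forall e, 0 < e -> z ^+ 2 <= (1 + e) * x ^+ 2 + (1 + e^-1) * y ^+ 2) ->
  z <= x + y.
Proof.
move=> x0 y0 z0 zxy; apply/ler_addgt0Pr => e e0.
have e20 : 0 < e / 2 by rewrite divr_gt0.
pose x' := x + e / 2; pose y' := y + e / 2.
have x'0 : 0 < x' by rewrite ltr_wpDl.
have y'0 : 0 < y' by rewrite ltr_wpDl.
have -> : x + y + e = x' + y' by rewrite /x' /y'; field.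
have xy'0 : 0 <= x' + y' by rewrite addr_ge0 ?ltW.
rewrite -(@ler_pXn2r _ 2)//; apply: (le_trans (zxy _ (divr_gt0 y'0 x'0))).
have -> : (x' + y') ^+ 2 = (1 + y' / x') * x' ^+ 2 + (1 + (y' / x')^-1) * y' ^+ 2.
  by field; rewrite !gt_eqF.
apply: lerD; apply: ler_wpM2l.
- by rewrite addr_ge0// divr_ge0// ltW.
- by rewrite ler_pXn2r ?nnegrE ?(ltW x'0)// lerDl ltW.
- by rewrite addr_ge0// invr_ge0 divr_ge0// ltW.
- by rewrite ler_pXn2r ?nnegrE ?(ltW y'0)// lerDl ltW.
Qed.

Lemma Sp_normD p u v : 0 <= p ->
  Sp_norm p (u + v : test_space Z) <= Sp_norm p u + Sp_norm p v.
Proof.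
move=> p0; apply: le_add_of_sqr_le; [exact: Sp_norm_ge0..|move=> e e0].
have := Sp_sqnormD_le p u v e0.
by rewrite (Sp_sqnormE (u + v) p0) (Sp_sqnormE u p0) (Sp_sqnormE v p0)
  -!EFinM -EFinD lee_fin.
Qed.

Lemma Sp_norm0 p : 0 <= p -> Sp_norm p (0 : test_space Z) = 0.
Proof.
move=> p0; apply/eqP; rewrite eq_le Sp_norm_ge0 andbT.
have := Sp_normZ_le 0 (0 : test_space Z) p0.
by rewrite scale0r Normc.normc0 mul0r.
Qed.

End Sp_seminorms.

(** * Limits in [R[i]] expressed with the real-valued modulus *)

Section complex_limits.
Variable R : realType.

Lemma normcE_C (z : R[i]) : `|z| = (Normc.normc z)%:C%C.
Proof. by []. Qed.

Lemma normc_ge0 (z : R[i]) : 0 <= Normc.normc z.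
Proof. by case: z => a b; exact: sqrtr_ge0. Qed.

Lemma normcD_le (x y : R[i]) :
  Normc.normc (x + y) <= Normc.normc x + Normc.normc y.
Proof. exact: (@le_normcD R x y). Qed.

Lemma Re_le_normc (z : R[i]) : `|complex.Re z| <= Normc.normc z.
Proof. by rewrite -lecR -normcE_C; exact: normc_ge_Re. Qed.

Lemma Im_le_normc (z : R[i]) : `|complex.Im z| <= Normc.normc z.
Proof.
by case: z => a b /=; rewrite -sqrtr_sqr ler_wsqrtr// lerDr sqr_ge0.
Qed.

Lemma normc_le_ReIm (z : R[i]) :
  Normc.normc z <= `|complex.Re z| + `|complex.Im z|.
Proof.
have -> : z = ((complex.Re z)%:C + (0 +i* complex.Im z))%C.
  by case: z => a b; rewrite /GRing.add/= addr0 add0r.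
apply: (le_trans (normcD_le _ _)).
by rewrite /= !expr0n/= !addr0 !add0r !sqrtr_sqr.
Qed.

(** The order of [R[i]] relates only numbers with equal imaginary parts. Radii of balls are thus
    real, although their type is complex. *)
Lemma complex_gt0_real (e : R[i]) : 0 < e -> exists2 r : R, 0 < r & e = r%:C%C.
Proof.
by case: e => a b; rewrite ltcE /= => /andP[/eqP -> a0]; exists a.
Qed.

Lemma complex_cvgP (X : Type) (F : set_system X) (FF : Filter F) (f : X -> R[i]^o)
  (l : R[i]^o) :
  f @ F --> l <-> forall e : R, 0 < e -> \forall x \near F, Normc.normc (l - f x) < e.
Proof.
split=> [/cvgrPdist_lt fl e e0|fl].
  have e0' : 0 < e%:C%C :> R[i] by rewrite ltcR.
  by apply: filterS (fl _ e0') => x; rewrite normcE_C ltcR.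
apply/cvgrPdist_lt => e /complex_gt0_real[r r0 ->].
by apply: filterS (fl _ r0) => x; rewrite normcE_C ltcR.
Qed.

Lemma real_cauchy_seq (x : nat -> R) :
  (forall e : R, 0 < e ->
    exists N, forall n m, (N <= n)%N -> (N <= m)%N -> `|x n - x m| < e) ->
  cvgn x.
Proof.
move=> xc; apply: cauchy_cvg; apply/cauchy_exP => e /xc[N xN].
by exists (x N); exists N => // n /= Nn; apply: xN.
Qed.

(** Completeness is inherited from the reals, applied to the real and imaginary parts. *)
Lemma complex_cauchy_seq (z : nat -> R[i]^o) :
  (forall e : R, 0 < e -> exists N, forall n m, (N <= n)%N -> (N <= m)%N ->
    Normc.normc (z n - z m) < e) ->
  cvgn z.
Proof.
move=> zc.
have cr : cvgn (fun n => complex.Re (z n)).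
  apply: real_cauchy_seq => e /zc[N zN]; exists N => n m Nn Nm.
  apply: le_lt_trans (zN _ _ Nn Nm); apply: le_trans (Re_le_normc _).
  by case: (z n) (z m) => [a b] [c f].
have ci : cvgn (fun n => complex.Im (z n)).
  apply: real_cauchy_seq => e /zc[N zN]; exists N => n m Nn Nm.
  apply: le_lt_trans (zN _ _ Nn Nm); apply: le_trans (Im_le_normc _).
  by case: (z n) (z m) => [a b] [c f].
apply/cvg_ex; exists (limn (fun n => complex.Re (z n)) +i* limn (fun n => complex.Im (z n)))%C.
apply/complex_cvgP => e e0.
have e20 : 0 < e / 2 by rewrite divr_gt0.
have /cvgrPdist_lt/(_ _ e20) Hr := cr; have /cvgrPdist_lt/(_ _ e20) Hi := ci.
apply: filterS2 Hr Hi => n /= hr hi; apply: (le_lt_trans (normc_le_ReIm _)).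
rewrite [ltRHS](splitr e); apply: ltrD.
- by apply: le_lt_trans hr; case: (z n) => a b.
- by apply: le_lt_trans hi; case: (z n) => a b.
Qed.

Lemma complex_cvg_bounded (z : nat -> R[i]^o) (l w : R[i]^o) (M : R) :
  z @ \oo --> l -> (forall n, Normc.normc (w - z n) <= M) -> Normc.normc (w - l) <= M.
Proof.
move=> /complex_cvgP zl zM; apply/ler_addgt0Pr => e /zl[N _ /(_ N (leqnn N)) /= lz].
rewrite -[w - l](subrKA (z N)).
apply: (le_trans (normcD_le _ _)); apply: lerD; first exact: zM.
by rewrite -normcN opprB ltW.
Qed.

End complex_limits.

(** * Strong duals of spaces topologized by a directed family of seminorms *)

Section seminormed_dual.
Context (R : realType) (E : preTopologicalLmodType R[i]) (I : Type).
Local Notation normc := Normc.normc.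

(** The last field asks for a ball of a single seminorm, not a finite intersection, so that
    continuity of a functional is controlled by one index. *)
Record generating_seminorms (N : I -> E -> R) : Prop := GeneratingSeminorms {
  seminorm_ge0 : forall i u, 0 <= N i u ;
  seminormD : forall i u v, N i (u + v) <= N i u + N i v ;
  seminormZ : forall i a u, N i (a *: u) <= normc a * N i u ;
  seminorm_nbhs : forall x V, nbhs x V <->
    exists i (e : R), 0 < e /\ forall y, N i (y - x) < e -> V y }.

Variable N : I -> E -> R.
Hypothesis gN : generating_seminorms N.
Implicit Types (Phi : strong_dual E) (u v : E) (B : set E).

Lemma functional_linear Phi : linear (Phi : E -> R[i]^o).
Proof. by have := functional_in Phi; rewrite inE => -[]. Qed.

Lemma functional_cont Phi : continuous (Phi : E -> R[i]^o).
Proof. by have := functional_in Phi; rewrite inE => -[]. Qed.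

Lemma functionalB Phi u v : Phi (u - v) = Phi u - Phi v.
Proof.
have := functional_linear Phi (-1) v u.
by rewrite !scaleN1r => Phivu; rewrite (addrC u) Phivu addrC.
Qed.

Lemma functional0 Phi : Phi 0 = 0.
Proof. by rewrite -[0 in LHS](subrr 0) functionalB subrr. Qed.

Lemma functionalZ Phi a u : Phi (a *: u) = a * Phi u.
Proof.
by have := functional_linear Phi a u 0; rewrite !addr0 functional0 addr0.
Qed.

Lemma functional_bounded Phi :
  exists i (C : R), 0 <= C /\ forall u, normc (Phi u) <= C * N i u.
Proof.
have := @functional_cont Phi 0.
move=> /complex_cvgP/(_ 1 ltr01)/(seminorm_nbhs gN)[i [e [e0 He]]].
(* Here e is the radius of a ball around 0 on which the modulus of Phi is below 1. *)
exists i, e^-1; split; first by rewrite invr_ge0 ltW.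
move=> u; rewrite ler_pdivlMl// leNgt; apply/negP => uN.
have Phi0 : 0 < normc (Phi u).
  by rewrite -(pmulr_rgt0 _ e0); apply: le_lt_trans uN; exact: seminorm_ge0.
have Phin0 : Phi u != 0.
  by apply: contraL Phi0 => /eqP ->; rewrite Normc.normc0 ltxx.
(* If the bound fails at u, then u / Phi(u) lies in that ball, yet Phi takes the value 1 there. *)
have := He ((Phi u)^-1 *: u); rewrite subr0 functional0 sub0r normcN functionalZ.
rewrite mulVf// Normc.normc1 ltxx => H; apply: notF; apply: H.
apply: (le_lt_trans (seminormZ gN _ _ _)).
by rewrite Normc.normcV ltr_pdivrMl// mulrC.
Qed.

Lemma bounded_linear_continuous (f : E -> R[i]^o) i (C : R) :
  linear f -> 0 <= C -> (forall u, normc (f u) <= C * N i u) -> continuous f.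
Proof.
move=> lf C0 fC x; apply/complex_cvgP => e e0; apply/(seminorm_nbhs gN).
(* C may be 0, hence the division by C + 1. *)
have C1 : 0 < C + 1 by rewrite ltr_wpDl.
exists i, (e / (C + 1)); split; first exact: divr_gt0.
move=> y; rewrite ltr_pdivlMr// mulrC => yx.
have -> : f x - f y = - f (y - x).
  have := lf (-1) x y; rewrite !scaleN1r (addrC (- x)) => ->.
  by rewrite opprD opprK.
rewrite normcN; apply: le_lt_trans (fC _) _; apply: le_lt_trans yx.
by rewrite ler_wpM2r ?(seminorm_ge0 gN)// lerDl.
Qed.

(** Absorption by the unit ball of a seminorm bounds that seminorm on B. Conversely, a ball of
    radius e absorbs B from the scale (|M| + 1) / e on, which is positive whatever the sign of M. *)
Lemma absorbed_boundedP B : absorbed_bounded B <->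
  forall i, exists M : R, forall u, B u -> N i u <= M.
Proof.
split=> [aB i|bB U /(seminorm_nbhs gN)[i [e [e0 eU]]]].
  have /aB[r r0 /(_ r)] : nbhs (0 : E) [set u | N i u < 1].
    by apply/(seminorm_nbhs gN); exists i, 1; split=> // y; rewrite subr0.
  rewrite gtr0_norm// lexx => /(_ isT) Br.
  exists (normc r) => u /Br[x /= /ltW x1 <-].
  apply: (le_trans (seminormZ gN _ _ _)).
  by rewrite -[leRHS]mulr1 ler_wpM2l// normc_ge0.
have [M BM] := bB i; pose r := (`|M| + 1) / e.
have r0 : 0 < r by rewrite divr_gt0// ltr_wpDl.
exists r%:C%C; first by rewrite ltcR.
move=> t; rewrite normcE_C lecR => rt u Bu.
have t0 : 0 < normc t by exact: lt_le_trans rt.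
have tn0 : t != 0 by apply: contraL t0 => /eqP ->; rewrite Normc.normc0 ltxx.
exists (t^-1 *: u); last by rewrite scalerA mulfV// scale1r.
apply: eU; rewrite subr0; apply: (le_lt_trans (seminormZ gN _ _ _)).
rewrite Normc.normcV ltr_pdivrMl//; apply: le_lt_trans (BM _ Bu) _.
apply: (@lt_le_trans _ _ (r * e)); last by rewrite ler_wpM2r// ltW.
by rewrite /r divfK ?gt_eqF// (le_lt_trans (ler_norm M))// ltrDl.
Qed.

Lemma entourage_normcP (A : set (R[i]^o * R[i]^o)) : entourage A <->
  exists2 e : R, 0 < e & [set xy | normc (xy.1 - xy.2) < e] `<=` A.
Proof.
rewrite -entourage_ballE; split=> [[_ /= /complex_gt0_real[e e0 ->] eA]|[e e0 eA]].
  exists e => // -[x y] /= xye; apply: eA => /=.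
  by rewrite -ball_normE /ball_ /= normcE_C ltcR.
exists e%:C%C; first by rewrite /= ltcR.
move=> -[x y] /=; rewrite -ball_normE /ball_ /= normcE_C ltcR => xye.
exact: eA.
Qed.

(** Open sets of the dual are preimages of open sets for uniform convergence on bounded sets, so
    convergence is tested there. *)
Lemma strong_dual_cvg (X : Type) (F : set_system X) (FF : Filter F)
    (f : X -> strong_dual E) Phi :
  (forall B (e : R), absorbed_bounded B -> 0 < e ->
    \forall x \near F, forall u, B u -> normc (Phi u - f x u) <= e) ->
  f @ F --> Phi.
Proof.
move=> fPhi.
have cf : (fun x => functional (f x)) @ F -->
    (functional Phi : {family @absorbed_bounded _ E, E -> R[i]^o}).
  apply/fam_cvgP => B aB V /uniform_nbhs[A [/entourage_normcP[e e0 eA] AV]].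
  (* The hypothesis bounds weakly and the entourage strictly; halving e bridges the two. *)
  have e20 : 0 < e / 2 by rewrite divr_gt0.
  apply: filterS (fPhi _ _ aB e20) => x fx; apply: AV => u Bu; apply: eA.
  by apply: (le_lt_trans (fx _ Bu)); rewrite ltr_pdivrMr// ltr_pMr// ltr1n.
move=> U [V [[W oW <-] WPhi WU]]; apply: filterS (WU) _.
exact: cf (open_nbhs_nbhs (conj oW WPhi)).
Qed.

(** Continuity of the inclusion of the dual into the functions with uniform convergence on bounded
    sets. *)
Lemma strong_dual_nbhs Phi B (e : R) : absorbed_bounded B -> 0 < e ->
  \forall Psi \near Phi,
    forall u, B u -> normc (Phi u - (Psi : strong_dual E) u) <= e.
Proof.
move=> aB e0.
have c : (@functional _ E) @ Phi -->
    (functional Phi : {family @absorbed_bounded _ E, E -> R[i]^o}).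
  exact: (@initial_continuous (strong_dual E) {family @absorbed_bounded _ E, E -> R[i]^o}
    (@functional _ E) Phi).
have cB : {uniform B, (@functional _ E) @ Phi --> (functional Phi : E -> R[i]^o)}.
  have FF : Filter ((@functional _ E) @ Phi).
    by apply: fmap_filter; exact: (@nbhs_filter (strong_dual E)).
  exact: ((@fam_cvgP E R[i]^o (@absorbed_bounded _ E) _ (functional Phi) FF).1 c).
have : nbhs (functional Phi : {uniform` B -> R[i]^o})
    [set h | forall u, B u -> normc (Phi u - h u) <= e].
  apply/uniform_nbhs.
  exists [set xy | normc (xy.1 - xy.2) < e]; split; last first.
    by move=> h Bh u /Bh /= /ltW.
  by apply/entourage_normcP; exists e.
exact: cB.
Qed.

End seminormed_dual.

(** * Transpose of a pointwise Cauchy, equicontinuous sequence of operators *)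

Section limit_transpose.
Context (R : realType) (E : preTopologicalLmodType R[i]) (I : Type).
Variables (N : I -> E -> R) (b : nat -> E -> E).
Local Notation normc := Normc.normc.

Hypothesis gN : generating_seminorms N.
Hypothesis b_linear : forall n, linear (b n).
(** Neither j nor C depends on n: this equicontinuity lets bounds pass to the limit. *)
Hypothesis b_bounded : forall i, exists j (C : R), 0 <= C /\
  forall n u, N i (b n u) <= C * N j u.
Hypothesis b_cauchy : forall i u (e : R), 0 < e -> exists n0,
  forall n m, (n0 <= n)%N -> (n0 <= m)%N -> N i (b n u - b m u) < e.

Implicit Types (Phi : strong_dual E) (u v : E).

(** Phi is bounded by one seminorm, so it sends the Cauchy sequence (b_n u) to a Cauchy sequence of
    scalars, and only these need a limit. *)
Lemma transpose_cvg Phi u : cvgn (fun n => Phi (b n u)).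
Proof.
apply: complex_cauchy_seq => e e0.
have [i [C [C0 PhiC]]] := functional_bounded gN Phi.
have C1 : 0 < C + 1 by rewrite ltr_wpDl.
have [n0 bn0] := b_cauchy i u (divr_gt0 e0 C1).
exists n0 => n m n0n n0m; rewrite -functionalB; apply: (le_lt_trans (PhiC _)).
have := bn0 _ _ n0n n0m; rewrite ltr_pdivlMr// mulrC; apply: le_lt_trans.
by rewrite ler_wpM2r ?(seminorm_ge0 gN)// lerDl.
Qed.

Definition limit_transpose_fun Phi (u : E) : R[i]^o := limn (fun n => Phi (b n u)).

Lemma limit_transpose_cvg Phi u :
  (fun n => Phi (b n u)) @ \oo --> limit_transpose_fun Phi u.
Proof. exact: transpose_cvg. Qed.

Lemma limit_transpose_unique Phi u (l : R[i]^o) :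
  (fun n => Phi (b n u)) @ \oo --> l -> limit_transpose_fun Phi u = l.
Proof. by move=> /cvg_lim; apply; exact: norm_hausdorff. Qed.

Lemma limit_transpose_linear_arg Phi : linear (limit_transpose_fun Phi).
Proof.
move=> a u v; apply: limit_transpose_unique.
rewrite (_ : (fun n => _) = (fun n => a *: Phi (b n u) + Phi (b n v))).
  by apply: cvgD; [apply: cvgZr|]; exact: limit_transpose_cvg.
by apply/funext => n; rewrite b_linear functional_linear.
Qed.

Lemma limit_transpose_bounded Phi i (C : R) :
  0 <= C -> (forall u, normc (Phi u) <= C * N i u) ->
  exists j (D : R), 0 <= D /\ forall u, normc (limit_transpose_fun Phi u) <= D * N j u.
Proof.
move=> C0 PhiC; have [j [D [D0 bD]]] := b_bounded i.
exists j, (C * D); split; first exact: mulr_ge0.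
(* The modulus is read as a distance from 0, the form in which bounds pass to limits. *)
move=> u; rewrite -normcN -sub0r.
apply: (complex_cvg_bounded (@limit_transpose_cvg Phi u)) => n.
rewrite sub0r normcN; apply: (le_trans (PhiC _)).
by rewrite -mulrA ler_wpM2l.
Qed.

Lemma limit_transpose_subproof Phi : limit_transpose_fun Phi \in @continuous_functional _ E.
Proof.
rewrite inE; split; first exact: limit_transpose_linear_arg.
have [i [C [C0 PhiC]]] := functional_bounded gN Phi.
have [j [D [D0 PhiD]]] := limit_transpose_bounded C0 PhiC.
exact: (bounded_linear_continuous gN (@limit_transpose_linear_arg Phi) D0 PhiD).
Qed.

Definition limit_transpose Phi : strong_dual E :=
  StrongDual (limit_transpose_subproof Phi).

Lemma limit_transpose_linear : linear limit_transpose.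
Proof.
move=> a Phi Psi; apply/val_inj/funext => u.
apply: limit_transpose_unique.
rewrite (_ : (fun n => _) = (fun n => a *: Phi (b n u) + Psi (b n u)))//.
apply: cvgD; last exact: (@limit_transpose_cvg Psi u).
by apply: cvgZr; exact: (@limit_transpose_cvg Phi u).
Qed.

HB.instance Definition _ := GRing.isLinear.Build R[i] (strong_dual E) (strong_dual E)
  _ limit_transpose limit_transpose_linear.

(** On B the transposes of Phi and Psi differ by the limit of (Phi - Psi)(b_n u), so closeness of
    Phi and Psi on the union of the b_n(B) suffices. *)
Lemma limit_transpose_continuous : continuous limit_transpose.
Proof.
move=> Phi; apply: (@strong_dual_cvg _ _ _ (nbhs Phi) (@nbhs_filter (strong_dual E) Phi)).
move=> B e aB e0.
have aB' : absorbed_bounded (\bigcup_n (b n @` B)).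
  apply/(absorbed_boundedP gN) => i; have [j [D [D0 bD]]] := b_bounded i.
  have [M BM] := (absorbed_boundedP gN B).1 aB j.
  exists (D * M) => _ [n _ [u Bu <-]]; apply: (le_trans (bD _ _)).
  by rewrite ler_wpM2l// BM.
apply: filterS (strong_dual_nbhs Phi aB' e0) => Psi PhiPsi u Bu.
rewrite -[normc _]normcN -sub0r.
apply: (@complex_cvg_bounded _ (fun n => Phi (b n u) - Psi (b n u))).
  exact: (cvgB (@limit_transpose_cvg Phi u) (@limit_transpose_cvg Psi u)).
by move=> n; rewrite sub0r normcN; apply: PhiPsi; exists n => //; exists u.
Qed.

Lemma limit_transpose_exists :
  exists a : {linear strong_dual E -> strong_dual E}, continuous a /\
    forall Phi u, (fun n => Phi (b n u)) @ \oo --> (a Phi u : R[i]^o).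
Proof.
exists limit_transpose; split; first exact: limit_transpose_continuous.
by move=> Phi u; exact: (@limit_transpose_cvg Phi u).
Qed.

End limit_transpose.

(** * Neighbourhoods in S(Z) as balls of a single norm *)

Section test_space_topology.
Context d (T : measurableType d) (R : realType) (P : probability T R).
Variable Z : normal_noise P.
Local Notation S := (test_space Z).
#[local] Opaque Sp_norm Sp_sqnorm.

(** Each ball leaves a margin around x. As the norms increase with p, the largest index and the
    smallest margin serve all the balls at once. *)
Lemma Sp_balls_inter (x : S) (F : seq (R * S * R)) :
  (forall q, q \in F -> [/\ 0 <= q.1.1, 0 < q.2 & Sp_norm q.1.1 (x - q.1.2 : S) < q.2]) ->
  exists p e, [/\ 0 <= p, 0 < e & forall y : S, Sp_norm p (y - x : S) < e ->
    forall q, q \in F -> Sp_norm q.1.1 (y - q.1.2 : S) < q.2].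
Proof.
elim: F => [_|q F IH Fx]; first by exists 0, 1.
have [|p [e [p0 e0 pe]]] := IH; first by move=> r rF; apply: Fx; rewrite inE rF orbT.
have [q0 r0 xq] := Fx q (mem_head _ _).
have e'0 : 0 < q.2 - Sp_norm q.1.1 (x - q.1.2 : S) by rewrite subr_gt0.
set e' := q.2 - _ in e'0.
have pm : p <= Num.max p q.1.1 by rewrite le_max lexx.
have qm : q.1.1 <= Num.max p q.1.1 by rewrite le_max lexx orbT.
have em : Num.min e e' <= e by rewrite ge_min lexx.
have em' : Num.min e e' <= e' by rewrite ge_min lexx orbT.
exists (Num.max p q.1.1), (Num.min e e').
split; [exact: le_trans pm|by rewrite lt_min e0|move=> y yx r].
rewrite in_cons => /predU1P[->|rF].
  have -> : y - q.1.2 = (y - x) + (x - q.1.2) by rewrite addrA subrK.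
  apply: (le_lt_trans (Sp_normD _ _ q0)); rewrite -ltrBrDr.
  exact: (le_lt_trans (Sp_norm_mono _ q0 qm) (lt_le_trans yx em')).
apply: (pe y _ r rF).
exact: (le_lt_trans (Sp_norm_mono _ p0 pm) (lt_le_trans yx em)).
Qed.

Lemma test_space_nbhsP (x : S) (V : set S) : nbhs x V <->
  exists p e, [/\ 0 <= p, 0 < e & forall y : S, Sp_norm p (y - x : S) < e -> V y].
Proof.
split=> [[B [[D sD <-] [A DA Ax] BV]]|[p [e [p0 e0 eV]]]].
  have [F sF AE] := sD _ DA.
  have [q qF|p [e [p0 e0 pe]]] := @Sp_balls_inter x F.
    have := sF _ qF; rewrite inE => -[q0 r0]; split=> //.
    by move: Ax; rewrite -AE => /(_ _ qF).
  exists p, e; split=> // y /pe Fy; apply: BV; exists A => //.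
  by suff : A y by []; rewrite -AE => q qF; exact: Fy.
(* A ball is itself a subbasic open set, hence a one-term union of one-term intersections. *)
pose U : set S := [set y | Sp_norm p (y - x : S) < e].
exists U; split=> //; last by rewrite /U /= subrr Sp_norm0.
exists [set U]; last by rewrite bigcup_set1.
move=> _ ->; exists [fset (p, x, e)]%fset.
  by move=> q; rewrite !inE => /eqP ->.
by rewrite set_fset1 bigcap_set1.
Qed.

Lemma Sp_norm_generating :
  generating_seminorms (fun (p : {nonneg R}) (u : S) => Sp_norm p%:num u).
Proof.
split.
- by move=> p u; exact: Sp_norm_ge0.
- by move=> p u v; exact: Sp_normD.
- by move=> p a u; exact: Sp_normZ_le.
move=> x V; split.
  move=> /test_space_nbhsP[p [e [p0 e0 eV]]].
  by exists (NngNum p0), e; split.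
by move=> [p [e [e0 eV]]]; apply/test_space_nbhsP; exists p%:num, e; split.
Qed.

End test_space_topology.

(** The sum is a supremum of finite partial sums. A partial sum within e of it leaves a remainder
    below e, finiteness allowing the subtraction. *)
Lemma esum_tail (R : realType) (I : choiceType) (D : set I) (a : I -> R) (e : R) :
  (forall i, 0 <= a i) -> (\esum_(i in D) (a i)%:E < +oo)%E -> 0 < e ->
  exists X : {fset I}, (\esum_(i in D `&` ~` [set` X]) (a i)%:E < e%:E)%E.
Proof.
move=> a0 Doo e0.
have a0' i : (0 <= (a i)%:E)%E by rewrite lee_fin.
have Dfin : (\esum_(i in D) (a i)%:E)%E \is a fin_num.
  by rewrite ge0_fin_numE// esum_ge0.
have [_ [X [finX XD] <-]] := ub_ereal_sup_adherent e0 Dfin.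
rewrite -/(esum D (fun i => (a i)%:E)) -esum_fset// => SX.
exists (fset_set X); rewrite fset_setK//.
have := @esumID R I X D (fun i => (a i)%:E) (fun i _ => a0' i).
rewrite (_ : D `&` X = X); last exact/setIidPr.
move=> DE; move: SX; rewrite DE.
have Xfin : (\esum_(i in X) (a i)%:E)%E \is a fin_num.
  rewrite ge0_fin_numE ?esum_ge0//; apply: le_lt_trans Doo.
  by rewrite DE leeDl// esum_ge0.
by rewrite lteBlDr// lteD2lE.
Qed.

(** * Truncated creation operators on S(Z) and their uniform estimates *)

Section truncated_creation.
Context d (T : measurableType d) (R : realType) (P : probability T R).
Variables (Z : normal_noise P) (k : nat).
Local Notation S := (test_space Z).
Local Notation normc := Normc.normc.
Local Notation coef s u := (L2_dot (noise_basis Z s) u).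
#[local] Opaque Sp_norm Sp_sqnorm.

(** The sum runs over the image sets t = s U k; the source s is recovered as t minus k when A
    contains only sets having k as an element. *)
Definition creation (A : {fset {fset nat}}) (u : S) : S :=
  \sum_(t <- A) coef (t `\ k)%fset u *: test_basis Z t.

Lemma test_val_sum (A : seq {fset nat}) (f : {fset nat} -> S) :
  test_val (\sum_(t <- A) f t) = \sum_(t <- A) test_val (f t).
Proof. by elim/big_rec2: _ => // t x y _ <-. Qed.

Lemma creation_linear A : linear (creation A).
Proof.
move=> a u v; rewrite /creation scaler_sumr -big_split; apply: eq_bigr => t _ /=.
by rewrite coefZD scalerDl scalerA.
Qed.

Lemma coef_creation A u t :
  coef t (creation A u) = if t \in A then coef (t `\ k)%fset u else 0.
Proof.
rewrite /creation test_val_sum.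
exact: (coef_combination Z A (fun t => coef (t `\ k)%fset u)).
Qed.

(** For t containing k, the term at t of the squared p-norm of the untruncated image of u. *)
Local Notation lterm p u t :=
  (weight R t `^ (2 * p) * normc (coef (t `\ k)%fset u) ^+ 2).

Lemma lterm_ge0 (p : R) (u : S) t : 0 <= lterm p u t.
Proof. by rewrite mulr_ge0 ?powR_ge0 ?sqr_ge0. Qed.

(** Reindexing by s |-> s U k over the sets s without k, where the weight gains exactly the factor k
    + 1. *)
Lemma lterm_esum_le (p : R) (u : S) :
  (\esum_(t in [set t : {fset nat} | k \in t]) (lterm p u t)%:E <=
   (k.+1%:R `^ (2 * p))%:E * Sp_sqnorm p u)%E.
Proof.
have bij : set_bij [set s : {fset nat} | k \notin s] [set t : {fset nat} | k \in t]
    (fsetU [fset k]%fset).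
  split=> [s _|s t /set_mem /= ks /set_mem /= kt /(congr1 (fsetD^~ [fset k]%fset))|t /= kt].
  - by rewrite /= fset1U1.
  - by rewrite !fsetU1K.
  - by exists (t `\ k)%fset; rewrite /= ?fsetD1K// !inE eqxx.
rewrite (reindex_esum _ _ _ _ bij) Sp_sqnorm_esum.
apply: (le_trans _ (esum_mulr_le (powR_ge0 _ _) (wterm_ge0 p u))).
rewrite esum_mkcond; apply: le_esum => s _.
case: ifPn => [/set_mem /= ks|_]; last by rewrite lee_fin mulr_ge0 ?powR_ge0 ?wterm_ge0.
by rewrite fsetU1K// weightU1// powRM ?(le_trans ler01 (weight_ge1 _ _))// mulrA.
Qed.

(** Used with D the sets containing k for the uniform bound, and with those outside a finite family
    for the Cauchy estimate. *)
Lemma Sp_sqnorm_le_lterm (p : R) (u v : S) (D : set {fset nat}) :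
  (forall t, D t -> normc (coef t v) <= normc (coef (t `\ k)%fset u)) ->
  (forall t, ~ D t -> coef t v = 0) ->
  (Sp_sqnorm p v <= \esum_(t in D) (lterm p u t)%:E)%E.
Proof.
move=> Dv nDv; rewrite Sp_sqnorm_esum [leRHS]esum_mkcond; apply: le_esum => t _.
case: ifPn => [/set_mem Dt|/negP Dt]; last first.
  by rewrite nDv ?Normc.normc0 ?expr0n ?mulr0// => /mem_set.
rewrite lee_fin ler_wpM2l ?powR_ge0// ler_pXn2r ?nnegrE ?normc_ge0//.
exact: Dv.
Qed.

(** The constant is (k + 1)^p, written as a root because it is compared after squaring; it is
    independent of A. *)
Lemma creation_bounded (p : R) (A : {fset {fset nat}}) (u : S) :
  0 <= p -> (forall t, t \in A -> k \in t) ->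
  Sp_norm p (creation A u) <= Num.sqrt (k.+1%:R `^ (2 * p)) * Sp_norm p u.
Proof.
move=> p0 Ak; rewrite Sp_norm_leP ?mulr_ge0 ?sqrtr_ge0 ?Sp_norm_ge0//.
rewrite exprMn sqr_sqrtr ?powR_ge0// EFinM -(Sp_sqnormE u p0).
apply: (le_trans _ (lterm_esum_le p u)); apply: Sp_sqnorm_le_lterm => t kt.
  by rewrite coef_creation; case: ifP => // _; rewrite Normc.normc0 normc_ge0.
by rewrite coef_creation; case: ifP => // /Ak.
Qed.

(** The two images have the same coefficients on X. Elsewhere their difference has at most the
    modulus of the full coefficient, so its norm is controlled by a tail. *)
Lemma creation_cauchy (p e : R) (u : S) : 0 <= p -> 0 < e ->
  exists X : {fset {fset nat}}, forall A B : {fset {fset nat}},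
    (forall t, t \in A -> k \in t) -> (forall t, t \in B -> k \in t) ->
    (forall t, t \in X -> k \in t -> (t \in A) && (t \in B)) ->
    Sp_norm p (creation A u - creation B u : S) < e.
Proof.
move=> p0 e0; pose e2 := (e / 2) ^+ 2.
have e20 : 0 < e2 by rewrite exprn_gt0// divr_gt0.
have foo : (\esum_(t in [set t : {fset nat} | k \in t]) (lterm p u t)%:E < +oo)%E.
  apply: (le_lt_trans (lterm_esum_le p u)).
  by rewrite (Sp_sqnormE u p0) -EFinM ltry.
have [X Xe] := esum_tail (lterm_ge0 p u) foo e20.
exists X => A B Ak Bk XAB; apply: (@le_lt_trans _ _ (e / 2)); last first.
  by rewrite ltr_pdivrMr// ltr_pMr// ltr1n.
have e20' : 0 <= e / 2 by rewrite divr_ge0// ltW.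
rewrite (Sp_norm_leP _ p0 e20'); apply: le_trans (ltW Xe).
have coefB t : coef t (test_val (creation A u - creation B u)) =
    coef t (creation A u) - coef t (creation B u).
  rewrite -[test_val _]/(test_val (creation A u) - test_val (creation B u)).
  by rewrite addrC -scaleN1r coefZD mulN1r addrC.
apply: Sp_sqnorm_le_lterm => t; rewrite coefB !coef_creation.
  move=> _; case: ifP => _; case: ifP => _; rewrite ?subr0 ?sub0r ?subrr ?normcN//;
    by rewrite Normc.normc0 normc_ge0.
have [kt|nkt] := boolP (k \in t); last first.
  have /negbTE -> : t \notin A by apply: contra nkt => /Ak.
  have /negbTE -> : t \notin B by apply: contra nkt => /Bk.
  by rewrite subrr.
have [tX _|tX] := boolP (t \in X).
  by have /andP[-> ->] := XAB _ tX kt; rewrite subrr.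
by case; split=> //; apply/negP.
Qed.

Lemma creation_basis (A : {fset {fset nat}}) (s : {fset nat}) :
  (forall t, t \in A -> k \in t) -> (k \notin s -> (k |` s)%fset \in A) ->
  creation A (test_basis Z s) = (1 - (k \in s)%:R) *: test_basis Z (k |` s)%fset.
Proof.
move=> Ak sA; rewrite /creation.
under eq_bigr do rewrite /= noise_basis_dot.
have [ks|ks] := boolP (k \in s).
  (* A set t minus k never contains k, so it cannot equal s. *)
  rewrite subrr scale0r big1// => t _; case: eqP => [ts|]; last by rewrite scale0r.
  by move: ks; rewrite -ts !inE eqxx.
(* Since every t in A contains k, only t = s U k gives s when k is removed. *)
rewrite subr0 (big_fsetD1 _ (sA ks))/= fsetU1K// eqxx big_seq big1 ?addr0// => t.
rewrite !inE => /andP[tks /Ak kt]; case: eqP => [ts|]; last by rewrite scale0r.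
by move: tks; rewrite -ts fsetD1K// eqxx.
Qed.

Definition sets_below (n : nat) : {fset {fset nat}} :=
  [fset t in fpowerset [fset i | i in iota 0 n] | k \in t]%fset.

Lemma sets_belowP n (t : {fset nat}) : reflect (k \in t /\ forall i, i \in t -> (i < n)%N)
  (t \in sets_below n).
Proof.
rewrite !inE fpowersetE; apply: (iffP andP) => [[/fsubsetP tn kt]|[kt tn]]; split=> //.
  by move=> i /tn; rewrite !inE mem_iota.
by apply/fsubsetP => i /tn; rewrite !inE mem_iota.
Qed.

Lemma sets_below_exhaust (X : {fset {fset nat}}) :
  exists n0, forall n t, (n0 <= n)%N -> t \in X -> k \in t -> t \in sets_below n.
Proof.
(* One more than the largest element occurring in X, as the bound in [sets_below] is strict. *)
exists (\max_(t <- X) \max_(i <- t) i).+1 => n t n0n tX kt.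
apply/sets_belowP; split=> // i it; apply: leq_trans n0n.
rewrite ltnS (big_fsetD1 t)//= (leq_trans _ (leq_maxl _ _))//.
by rewrite (big_fsetD1 i)//= leq_maxl.
Qed.

End truncated_creation.

(** * The annihilation operator as the limit transpose of truncated creations *)

Theorem theorem3p1 (R : realType) (d : measure_display) (T : measurableType d)
  (P : probability T R) (Z : normal_noise P)
  (hZ : chaotic_representation Z) (k : nat) :
  exists a : {linear strong_dual (test_space Z) -> strong_dual (test_space Z)},
    continuous a /\
    forall (s : {fset nat}) (Phi : strong_dual (test_space Z)),
      fock_transform (a Phi) s =
      (1 - (k \in s)%:R) * fock_transform Phi (k |` s)%fset.
Proof.
pose b n : test_space Z -> test_space Z := creation k (sets_below k n).
have kG n t : t \in sets_below k n -> k \in t by case/sets_belowP.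
have [p|p u e e0|a [ca aE]] := @limit_transpose_exists R (test_space Z) _ _ b
    (Sp_norm_generating Z) (fun n => @creation_linear _ _ _ _ Z k _).
- exists p, (Num.sqrt (k.+1%:R `^ (2 * p%:num))); split; first exact: sqrtr_ge0.
  by move=> n u; apply: creation_bounded => // t; exact: kG.
- have [X XE] := creation_cauchy k u (ge0 p) e0.
  have [n0 Xn0] := sets_below_exhaust k X.
  exists n0 => n m n0n n0m; apply: XE => [t|t|t tX kt]; [exact: kG..|].
  by rewrite !Xn0.
exists a; split=> // s Phi.
(* Once n exceeds every element of s U k, b_n(Z_s) no longer depends on n, so the limit defining the
   Fock transform at s is that of an eventually constant sequence. *)
have [n0 sn0] := sets_below_exhaust k [fset (k |` s)%fset]%fset.
rewrite /fock_transform -functionalZ.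
apply: (@cvg_unique _ (@norm_hausdorff _ R[i]^o) _ _ _ _ (aE Phi (test_basis Z s))).
apply: cvg_near_cst; exists n0 => // n /= n0n.
rewrite /b creation_basis// => [t|_]; first exact: kG.
by apply: sn0; rewrite ?fset1U1// inE.
Qed.
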